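(* Assume that for every $q>0$: (B1-$q$) $\displaystyle\sup_{n\ge1}\max_{l\in\{1,2\}}\sup_{0\le t\le(n-1)h_n}E[(\mathcal N^{n,l}_{t+h_n}-\mathcal N^{n,l}_t)^q]<\infty$; (B2-$q$) $\displaystyle\limsup_{u\to\infty}\sup_{n\ge1}\max_{l\in\{1,2\}}\sup_{0\le t\le nh_n-uh_n}u^qP(\mathcal N^{n,l}_{t+uh_n}-\mathcal N^{n,l}_t=0)<\infty$; and $\displaystyle\sup_{n\in\mathbb N}\sum_{k=0}^\infty(k+1)^q\alpha_k^n<\infty$. Moreover, assume that there exist positive constants $a_0^1,a_0^2$ and nonnegative constants $a_p^1$ ($p\in\mathbb N$) such that $$\max_{1\le k\le q_n}|h_nE[M_{l,k}]-a_0^l(s_k-s_{k-1})|\to0,\qquad \max_{1\le k\le q_n}|h_nE[\mathrm{tr}(\mathcal E^1_{(k)}(GG^\top)^p)]-a_p^1(s_k-s_{k-1})|\to0$$ as $n\to\infty$ for all $p\in\mathbb Z_+$, $l\in\{1,2\}$ and any partition $(s_k)_{k=0}^\infty\in\mathfrak S$. Then there exist positive constants $a_0^1,a_0^2$ such that, for $l\in\{1,2\}$ and any $(s_k)\in\mathfrak S$, $\{h_nM_{l,q_n+1}\}_{n\ge1}$ is tight and $\max_{1\le k\le q_n}|h_nM_{l,k}-a_0^l(s_k-s_{k-1})|\to0$ in probability; and for any $p\in\mathbb N$ there exists a nonnegative constant $a_p^1$ such that $\max_{1\le k\le q_n}|h_n\mathrm{tr}(\mathcal E^1_{(k)}(GG^\top)^p)-a_p^1(s_k-s_{k-1})|\to0$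 in probability for any $(s_k)\in\mathfrak S$.
   Context: $(h_n)_{n\ge1}$ are positive numbers with $h_n\to0$, $T_n:=nh_n\to\infty$, $nh_n^2\to0$. For each $n$ and $l\in\{1,2\}$, $0=S^{n,l}_0<S^{n,l}_1<\dots<S^{n,l}_{M_l}=T_n$ are random times ($M_l$ a random positive integer depending on $n$). $I_i^l=(S^{n,l}_{i-1},S_i^{n,l}]$, $|\cdot|$ is interval length. $G$ is the $M_1\times M_2$ matrix $[G]_{ij}=|I_i^1\cap I_j^2|/(|I_i^1|^{1/2}|I_j^2|^{1/2})$. $\mathfrak S$ is the set of partitions $0=s_0<s_1<\cdots$ of $[0,\infty)$ with $\sup_{k\ge1}|s_k-s_{k-1}|\le1$ and $\inf_{k\ge1}|s_k-s_{k-1}|>0$. For $(s_k)\in\mathfrak S$: $q_n=\max\{k:s_k\le nh_n\}$, $M_{l,k}=\#\{i:\sup I_i^l\in(s_{k-1},s_k]\}$, and $\mathcal E^l_{(k)}$ is the $M_l\times M_l$ diagonal matrix with $i$th diagonal entry $1$ if $\sup I_i^l\in(s_{k-1},s_k]$ and $0$ otherwise. $\mathcal N^{n,l}_t=\sum_{i=1}^{M_l}1_{\{S_i^{n,l}\le t\}}$. Mixing coefficients: $\mathcal G^n_{i,j}=\sigma(\mathcal N^{n,l}_t-\mathcal N^{n,l}_s;\ ih_n\le s<t\le jh_n,\ l=1,2)$ for $0\le i,j\le n$, and $$\alpha_k^n=0\vee\sup_{1\le i,j\le n-1,\ j-i\ge k}\ \sup_{A\in\mathcal G^n_{0,i}}\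 \sup_{B\in\mathcal G^n_{j,n}}|P(A\cap B)-P(A)P(B)|.$$ $\mathbb Z_+=\{0,1,2,\dots\}$, $\mathbb N=\{1,2,\dots\}$. *)

(* Defs.v *)
From HB Require Import structures.
From mathcomp Require Import all_boot all_order all_algebra.
From mathcomp Require Import all_classical all_reals all_analysis.

Set Implicit Arguments.
Unset Strict Implicit.
Unset Printing Implicit Defensive.

Import Order.TTheory GRing.Theory Num.Theory.
Import numFieldNormedType.Exports.

Local Open Scope classical_set_scope.
Local Open Scope ring_scope.

(* The two components l = 1, 2 are the elements ord0, ord_max of 'I_2. *)

(* One realisation of the sampling times is a sequence S_0 < ... < S_m; only the
   values S i with i <= m are meaningful. *)
Section path.
Context {R : realType}.

(* I_i = (S_{i-1}, S_i], used for i >= 1 *)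
Definition obs_itv (S : nat -> R) (i : nat) : set R :=
  [set` `]S i.-1, S i]].

Definition len (A : set R) : R := fine (lebesgue_measure A).

(* 'I_m is 0-based, so row i is the interval I_{i+1}. *)
Definition overlap_mx (m1 m2 : nat) (S1 S2 : nat -> R) : 'M[R]_(m1, m2) :=
  \matrix_(i, j)
    (len (obs_itv S1 i.+1 `&` obs_itv S2 j.+1) /
     (Num.sqrt (len (obs_itv S1 i.+1)) * Num.sqrt (len (obs_itv S2 j.+1)))).

Definition sup_in (S : nat -> R) (a b : R) (i : nat) : bool :=
  sup (obs_itv S i) \in `]a, b].

Definition block_count (m : nat) (S : nat -> R) (a b : R) : nat :=
  #|[pred i : 'I_m | sup_in S a b i.+1]|.

Definition block_diag (m : nat) (S : nat -> R) (a b : R) : 'M[R]_m :=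
  diag_mx (\row_i (if sup_in S a b i.+1 then 1 else 0)).

Definition block_trace (m1 m2 : nat) (S1 S2 : nat -> R) (p : nat) (a b : R) : R :=
  let G := overlap_mx m1 m2 S1 S2 in
  \tr (block_diag m1 S1 a b *m (G *m G^T) ^+ p).

Definition count_upto (m : nat) (S : nat -> R) (t : R) : nat :=
  (\sum_(1 <= i < m.+1) (S i <= t)%R)%N.

(* The infimum and supremum are taken in \bar R because sup and inf in R take
   a default value on unbounded sets. *)
Definition good_partition (s : nat -> R) : Prop :=
  [/\ s 0%N = 0,
      forall k, s k < s k.+1,
      (ereal_sup [set `|s k - s k.-1|%:E | k in [set k | (0 < k)%N]] <= 1)%E &
      (0 < ereal_inf [set `|s k - s k.-1|%:E | k in [set k | (0 < k)%N]])%E].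

(* max {k | s k <= t} *)
Definition last_index (s : nat -> R) (t : R) : nat :=
  xget 0%N [set q | s q <= t /\ forall k, s k <= t -> (k <= q)%N].

End path.

Section random.
Context {d : measure_display} {T : measurableType d} {R : realType}.
Variable P : probability T R.

Implicit Types (h : nat -> R) (s : nat -> R).

(* M n l w is the number of intervals and S n l i w the i-th sampling time; the
   latter is a random time on the event where it exists. *)
Definition sampling_times h (M : nat -> 'I_2 -> T -> nat)
    (S : nat -> 'I_2 -> nat -> T -> R) : Prop :=
  forall n l, (0 < n)%N ->
  [/\ measurable_fun setT (M n l),
      forall i, measurable_fun [set w | (i <= M n l w)%N] (S n l i) &
      forall w, [/\ (0 < M n l w)%N,
        S n l 0%N w = 0,
        forall i, (i < M n l w)%N -> S n l i w < S n l i.+1 w &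
        S n l (M n l w) w = n%:R * h n]].

Section sampling.
Variables (h : nat -> R) (M : nat -> 'I_2 -> T -> nat).
Variable S : nat -> 'I_2 -> nat -> T -> R.

(* N^{n,l}_{t2} - N^{n,l}_{t1} *)
Definition incr (n : nat) (l : 'I_2) (t1 t2 : R) (w : T) : R :=
  (count_upto (M n l w) (S n l ^~ w) t2)%:R -
  (count_upto (M n l w) (S n l ^~ w) t1)%:R.

Definition qn s (n : nat) : nat := last_index s (n%:R * h n).

(* M_{l,k}, for k >= 1 *)
Definition Mk s (n : nat) (l : 'I_2) (k : nat) (w : T) : R :=
  (block_count (M n l w) (S n l ^~ w) (s k.-1) (s k))%:R.

(* tr (E^1_(k) (G G^T)^p), for k >= 1 *)
Definition trk s (n p k : nat) (w : T) : R :=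
  block_trace (M n ord0 w) (M n ord_max w) (S n ord0 ^~ w) (S n ord_max ^~ w)
    p (s k.-1) (s k).

Definition B1 (q : R) : Prop :=
  (ereal_sup [set \big[maxe/-oo]_(l < 2)
      ereal_sup [set 'E_P[fun w => (incr n l t (t + h n) w `^ q)%R]
                | t in [set t | (0 <= t <= (n%:R - 1) * h n)%R]]
    | n in [set n | (0 < n)%N]] < +oo)%E.

Definition B2 (q : R) : Prop :=
  (limf_esup (fun u : R =>
    ereal_sup [set \big[maxe/-oo]_(l < 2)
      ereal_sup [set (u `^ q)%:E * P [set w | incr n l t (t + u * h n)%R w = 0%R]
                | t in [set t | (0 <= t <= n%:R * h n - u * h n)%R]]
    | n in [set n | (0 < n)%N]]) (pinfty_nbhs R) < +oo)%E.

Definition incr_sigma (n i j : nat) : set (set T) :=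
  <<s [set A | exists (l : 'I_2) (t1 t2 : R) (B : set R),
       [/\ i%:R * h n <= t1, t1 < t2, t2 <= j%:R * h n, measurable B &
           A = incr n l t1 t2 @^-1` B]] >>.

Definition alpha (n k : nat) : \bar R :=
  maxe 0%E (ereal_sup [set
    ereal_sup [set
      ereal_sup [set `|P (A `&` B) - P A * P B|%E | B in incr_sigma n ij.2 n]
      | A in incr_sigma n 0 ij.1]
    | ij in [set ij : nat * nat |
        [/\ (1 <= ij.1 <= n.-1)%N, (1 <= ij.2 <= n.-1)%N &
            (ij.1 + k <= ij.2)%N]]]).

Definition mixing_summable (q : R) : Prop :=
  (ereal_sup [set \sum_(0 <= k <oo) (k.+1%:R `^ q)%:E * alpha n k
             | n in [set n | (0 < n)%N]] < +oo)%E.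

End sampling.

Definition cvg_max_mean h s (X : nat -> nat -> T -> R) (a : R) : Prop :=
  ((\big[maxe/0]_(1 <= k < (qn h s n).+1)
      `|(h n)%:E * 'E_P[X n k] - (a * (s k - s k.-1))%:E|)
    @[n --> \oo] --> 0)%E.

Definition cvg_in_prob (Y : nat -> T -> R) (c : R) : Prop :=
  forall e : R, 0 < e ->
    P [set w | e < `|Y n w - c|] @[n --> \oo] --> 0%E.

Definition cvg_max_prob h s (X : nat -> nat -> T -> R) (a : R) : Prop :=
  cvg_in_prob (fun n w => \big[Num.max/0]_(1 <= k < (qn h s n).+1)
                            `|h n * X n k w - a * (s k - s k.-1)|) 0.

(* tightness of the family (Y n)_{n >= 1} *)
Definition tight (Y : nat -> T -> R) : Prop :=
  forall e : R, 0 < e -> exists K : R,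
    forall n, (0 < n)%N -> (P [set w | (K < `|Y n w|)%R] <= e%:E)%E.

End random.

(* Main.v *)
Require Import Defs.
From HB Require Import structures.
From mathcomp Require Import all_boot all_order all_algebra.
From mathcomp Require Import all_classical all_reals all_analysis.
From mathcomp Require Import measurable_realfun.
From mathcomp Require Import ring lra zify.

Import Order.TTheory GRing.Theory Num.Theory.
Import numFieldNormedType.Exports.

Local Open Scope classical_set_scope.
Local Open Scope ring_scope.

(** The block expectations converge by assumption, so the theorem is a law of
large numbers, and it rests on one variance bound: for a block (x, y] of
length at most 1, the trace restricted to the block has variance O(1/h_n)
([block_var], [block_chebyshev]).  After multiplication by h_n the variance is
O(h_n); there are O(n h_n) blocks up to time n h_n, so Chebyshev's inequality
and a union bound give a probability O(n h_n^2), which vanishes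
([deviation_bound], [cvg_mean_prob]).  Tightness of the last block is Markov's
inequality, since the mean number of observations in it is O(1/h_n).

For the variance bound, a block is cut into about 1/h_n cells
(j h_n, (j+1) h_n], and the covariance of the contributions of the cells j and
k is shown to be O(|j - k|^-2) ([cell_cov]), which is summable.  Three facts
enter.

- Size.  Conjugating G G^T by the diagonal matrix of the square roots of the
  interval lengths turns it into the transition matrix of a random walk which
  moves between overlapping intervals.  Its powers have diagonal entries in
  [0, 1] ([walk_le1]), so a cell contributes at most its number of
  observations, whose fourth moment is bounded by [B1].

- Locality.  A diagonal entry of (G G^T)^p is a sum over closed walks with 2p
  steps between overlapping intervals.  If each of 2p consecutive stretches of
  time to the right of a cell contains observations of both processes, no walk
  starting in the cell goes past the last stretch; likewise to the left, with
  one more stretch ([loop_sum_left], [loop_sum_right]).  Then the contribution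
  of the cell is a function of the observations in a window.  By [B2], a
  stretch of length u h_n is empty with probability O(u^-4) ([B2_void]).

- Mixing.  The windowed contributions are measurable for the increments of the
  counting processes over the window ([local_trace_sigma_left],
  [local_trace_sigma_right]): on the event that the window contains given
  numbers of points, they are explicit measurable functions of these points.
  With u proportional to k - j, the windows of the cells j and k are still
  separated by u cells, so their covariance is governed by the mixing
  coefficient of order u, which is O(u^-4).

These are combined in [cov_mixing_local], where the contributions are moreover
truncated at level u + 1 to make the mixing coefficient applicable; each of the
errors is then O(u^-2).

The counts M_{l,k} are the case p = 0, both families of intervals being that of
the process l. *)

Set Implicit Arguments.
Unset Strict Implicit.
Unset Printing Implicit Defensive.

(** * Walks between overlapping intervals *)

Section walks.
Context {R : realType}.
Implicit Types (I J : R * R) (Is Js : seq (R * R)) (s : seq R).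

Definition intervals s : seq (R * R) := zip s (behead s).

(** Projection of the line onto J. *)
Definition clamp (J : R * R) (x : R) : R := Num.min (Num.max x J.1) J.2.

Definition overlap I J : R := Num.max 0 (Num.min I.2 J.2 - Num.max I.1 J.1).

Definition itv_len I : R := I.2 - I.1.

(** Entry of the matrix G for the pair of intervals I, J. *)
Definition weight I J : R := overlap I J / (Num.sqrt (itv_len I) * Num.sqrt (itv_len J)).

(** Entry (I, I') of (G G^T)^p.  Indexing by lists of intervals makes the
restriction to a subfamily an instance of the same definition.  At p = 0 the
weight stands for the Kronecker symbol: both agree on disjoint intervals, and
the weight is visibly measurable in the endpoints. *)
Fixpoint walk Is Js (p : nat) I I' : R :=
  if p is p'.+1 then
    \sum_(J <- Js) \sum_(I'' <- Is) weight I J * weight I'' J * walk Is Js p' I'' I'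
  else weight I I'.

(** Contribution to the trace of the intervals whose right endpoint satisfies C. *)
Definition loop_sum (C : pred R) Is Js (p : nat) : R :=
  \sum_(I <- Is | C I.2) walk Is Js p I I.

Lemma overlap_ge0 I J : 0 <= overlap I J.
Proof. by rewrite /overlap le_max lexx. Qed.

Lemma overlapC I J : overlap I J = overlap J I.
Proof. by rewrite /overlap [Num.min I.2 _]minC [Num.max I.1 _]maxC. Qed.

Lemma weight_ge0 I J : 0 <= weight I J.
Proof. by rewrite divr_ge0 ?overlap_ge0// mulr_ge0// sqrtr_ge0. Qed.

Lemma weightC I J : weight I J = weight J I.
Proof. by rewrite /weight overlapC [_ * Num.sqrt (itv_len J)]mulrC. Qed.

Lemma walk_ge0 Is Js p I I' : 0 <= walk Is Js p I I'.
Proof.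
elim: p I => [|p IHp] I /=; first exact: weight_ge0.
apply: sumr_ge0 => J _; apply: sumr_ge0 => I'' _; apply: mulr_ge0 (IHp _).
exact: mulr_ge0 (weight_ge0 _ _) (weight_ge0 _ _).
Qed.

Lemma weight_eq0 I J : ~~ ((I.1 < J.2) && (J.1 < I.2)) -> I.1 < I.2 -> J.1 < J.2 ->
  weight I J = 0.
Proof.
move=> h hI hJ; suff -> : weight I J = 0 / (Num.sqrt (itv_len I) * Num.sqrt (itv_len J)) by rewrite mul0r.
congr (_ / _); apply/max_idPl; rewrite subr_le0.
by move: h; rewrite ge_min !le_max negb_and -!leNgt => /orP[] ->; rewrite ?orbT.
Qed.

Lemma weight_diag I : I.1 < I.2 -> weight I I = 1.
Proof.
move=> hI; rewrite /weight /overlap minxx maxxx -expr2 sqr_sqrtr ?subr_ge0 1?ltW//.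
have h0 : 0 < I.2 - I.1 by rewrite subr_gt0.
by rewrite max_r ?divff ?gt_eqF// ltW.
Qed.

(** With J fixed, the overlap is an increment of a monotone bounded function,
hence overlaps telescope along consecutive intervals. *)
Lemma overlap_clamp I J : I.1 <= I.2 -> J.1 <= J.2 -> overlap I J = clamp J I.2 - clamp J I.1.
Proof.
move=> hI hJ; rewrite /overlap /clamp.
case: (ltP I.2 J.2) => h1; case: (ltP I.1 J.1) => h2; case: (ltP I.2 J.1) => h3;
  case: (ltP I.1 J.2) => h4; try lra; rewrite /Num.min /Num.max;
  repeat (case: ltP => ?; try lra).
Qed.

Lemma clamp_bounds J x : J.1 <= J.2 -> J.1 <= clamp J x <= J.2.
Proof.
move=> hJ; rewrite /clamp.
case: (ltP x J.1) => h1; rewrite /Num.min; by case: ltP => h2; apply/andP; split; lra.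
Qed.

Lemma intervals_cons x s : intervals (x :: s) = if s is y :: _ then (x, y) :: intervals s else [::].
Proof. by case: s. Qed.

Lemma intervals_lt s I : sorted <%R s -> I \in intervals s -> I.1 < I.2.
Proof.
elim: s => // x [|y s] IHs // /andP[xy ys].
by rewrite intervals_cons inE => /orP[/eqP -> //|]; apply: IHs.
Qed.

Lemma intervals_mem s I : I \in intervals s -> I.1 \in s /\ I.2 \in s.
Proof.
elim: s => // x [|y s] IHs //; rewrite intervals_cons in_cons => /orP[/eqP -> /=|/IHs[h1 h2]].
  by rewrite !inE !eqxx orbT.
by split; rewrite in_cons ?h1 ?h2 orbT.
Qed.

(** The source of locality: a consecutive interval cannot straddle a point of
the subdivision. *)
Lemma intervals_gap s I x : sorted <%R s -> I \in intervals s -> x \in s ->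
  x <= I.1 \/ I.2 <= x.
Proof.
elim: s => // z [|y s] IHs // zys.
have /andP[zy ys] := zys.
rewrite intervals_cons in_cons => /orP[/eqP -> /=|hI].
  rewrite in_cons => /orP[/eqP ->|]; first by left.
  rewrite in_cons => /orP[/eqP ->|xs]; first by right.
  by right; rewrite ltW//; exact: (allP (order_path_min lt_trans ys)).
rewrite in_cons => /orP[/eqP ->|]; last exact: IHs.
left; have /intervals_mem[h _] := hI.
by rewrite ltW//; exact: (allP (order_path_min lt_trans zys)).
Qed.

Lemma intervals_disj s I I' : sorted <%R s -> I \in intervals s -> I' \in intervals s ->
  I != I' -> weight I I' = 0.
Proof.
move=> ss hI hI' nII'; apply: weight_eq0; [|exact: intervals_lt ss _..].
apply/negP => /andP[h1 h2].
have [I1 I2] := intervals_mem hI; have [I'1 I'2] := intervals_mem hI'.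
have := intervals_gap ss hI I'1; have := intervals_gap ss hI I'2.
have := intervals_gap ss hI' I1; have := intervals_gap ss hI' I2.
have := intervals_lt ss hI; have := intervals_lt ss hI'.
case: I I' nII' h1 h2 {hI hI' I1 I2 I'1 I'2} => a b [c e] /= nII' h1 h2 h3 h4 h5 h6 h7 h8.
have [ac be] : a = c /\ b = e by split; lra.
by move: nII'; rewrite ac be eqxx.
Qed.

Lemma sum_overlap_intervals s J : sorted <%R s -> J.1 < J.2 ->
  \sum_(I <- intervals s) overlap I J <= itv_len J.
Proof.
move=> ss hJ.
have [->|] := eqVneq s [::]; first by rewrite big_nil /itv_len subr_ge0 ltW.
case: s ss => // x s ss _.
suff -> : \sum_(I <- intervals (x :: s)) overlap I J = clamp J (last x s) - clamp J x.
  have := clamp_bounds x (ltW hJ); have := clamp_bounds (last x s) (ltW hJ).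
  by rewrite /itv_len; lra.
elim: s x ss => [|y s IHs] x; first by rewrite big_nil subrr.
move=> /= /andP[xy ys]; rewrite intervals_cons big_cons IHs// overlap_clamp/= ?(ltW xy) ?(ltW hJ)//.
lra.
Qed.

Lemma itv_len_sqrt I : I.1 < I.2 -> itv_len I = Num.sqrt (itv_len I) * Num.sqrt (itv_len I).
Proof. by move=> hI; rewrite -expr2 sqr_sqrtr// subr_ge0 ltW. Qed.

Lemma sqrt_itv_len_gt0 I : I.1 < I.2 -> 0 < Num.sqrt (itv_len I).
Proof. by move=> hI; rewrite sqrtr_gt0 subr_gt0. Qed.

Lemma sum_weight_intervals s J : sorted <%R s -> J.1 < J.2 ->
  \sum_(I <- intervals s) weight I J * Num.sqrt (itv_len I) <= Num.sqrt (itv_len J).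
Proof.
move=> ss hJ.
have vJ := sqrt_itv_len_gt0 hJ.
have -> : \sum_(I <- intervals s) weight I J * Num.sqrt (itv_len I) =
  (\sum_(I <- intervals s) overlap I J) / Num.sqrt (itv_len J).
  rewrite mulr_suml; apply: eq_big_seq => I /(intervals_lt ss) hI.
  by rewrite /weight invfM mulrA -mulrA [_^-1 * Num.sqrt _]mulrC mulrA mulfVK ?gt_eqF ?sqrt_itv_len_gt0.
by rewrite ler_pdivrMr// -itv_len_sqrt// sum_overlap_intervals.
Qed.

(** The vector of square roots of lengths is subinvariant under G and under its
transpose, because the overlaps of an interval with disjoint ones add up to at
most its length. *)
Lemma sum_walk_intervals s1 s2 p I : sorted <%R s1 -> sorted <%R s2 -> I.1 < I.2 ->
  \sum_(I' <- intervals s1) walk (intervals s1) (intervals s2) p I I' * Num.sqrt (itv_len I')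
    <= Num.sqrt (itv_len I).
Proof.
move=> ss1 ss2; elim: p I => [|p IHp] I hI /=.
  by under eq_bigr do rewrite weightC; exact: sum_weight_intervals.
under eq_bigr do (rewrite mulr_suml; under eq_bigr do rewrite mulr_suml).
rewrite exchange_big /=.
apply: le_trans (_ : \sum_(J <- intervals s2) weight J I * Num.sqrt (itv_len J) <= _); last first.
  exact: sum_weight_intervals.
rewrite big_seq [leRHS]big_seq; apply: ler_sum => J hJ.
rewrite exchange_big /=.
apply: le_trans (_ : weight J I *
    (\sum_(I'' <- intervals s1) weight I'' J * Num.sqrt (itv_len I'')) <= _); last first.
  by rewrite ler_wpM2l ?weight_ge0// sum_weight_intervals// (intervals_lt ss2).
rewrite mulr_sumr.
rewrite [leLHS]big_seq [leRHS]big_seq; apply: ler_sum => I'' hI''.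
rewrite [weight J I]weightC mulrA.
under eq_bigr do rewrite -mulrA.
by rewrite -mulr_sumr ler_wpM2l ?IHp ?(intervals_lt ss1)// mulr_ge0 ?weight_ge0.
Qed.

(** A diagonal entry times the square root of the length of I is one of the
nonnegative terms of the sum bounded in the previous lemma. *)
Lemma walk_le1 s1 s2 p I : sorted <%R s1 -> sorted <%R s2 -> I \in intervals s1 ->
  walk (intervals s1) (intervals s2) p I I <= 1.
Proof.
move=> ss1 ss2 hI; have hI' := intervals_lt ss1 hI.
rewrite -(ler_pM2r (sqrt_itv_len_gt0 hI')) mul1r.
apply: le_trans (sum_walk_intervals p ss1 ss2 hI').
rewrite (big_rem I)//= lerDl sumr_ge0// => I' _.
by rewrite mulr_ge0 ?walk_ge0 ?sqrtr_ge0.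
Qed.

Lemma size_intervals_count (C : pred R) x s :
  size [seq I <- intervals (x :: s) | C I.2] = count C s.
Proof.
elim: s x => // y s IHs x; rewrite intervals_cons /=.
by case: ifP => _ /=; rewrite IHs.
Qed.

Lemma loop_sum_ge0 C Is Js p : 0 <= loop_sum C Is Js p.
Proof. by apply: sumr_ge0 => I _; exact: walk_ge0. Qed.

Lemma loop_sum_le C s1 s2 p : sorted <%R s1 -> sorted <%R s2 ->
  loop_sum C (intervals s1) (intervals s2) p <= (count C (behead s1))%:R.
Proof.
move=> ss1 ss2.
apply: (@le_trans _ _ (\sum_(I <- intervals s1 | C I.2) 1)).
  rewrite /loop_sum [leLHS]big_seq_cond [leRHS]big_seq_cond; apply: ler_sum => I /andP[hI _].
  exact: walk_le1.
rewrite big_const_seq iter_addr addr0 ler_nat -size_filter.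
by case: s1 ss1 => // x s1 ss1; rewrite size_intervals_count.
Qed.

(** Q i describes where a walk may be after i half-steps; each passage to an
overlapping interval uses up one index.  Once all positions up to the last one
are known to lie in B, intervals outside B may be discarded, since every walk
with a nonzero weight avoids them. *)
Lemma walk_local (Q : nat -> pred (R * R)) (B : pred (R * R)) Is Js p k I I' :
  (forall i, {subset Q i <= Q i.+1}) ->
  (forall J, (J \in Is) || (J \in Js) -> J.1 < J.2) ->
  (forall i J J', (i < k + p.*2)%N -> (J \in Is) || (J \in Js) ->
     (J' \in Is) || (J' \in Js) -> Q i J -> J.1 < J'.2 -> J'.1 < J.2 -> Q i.+1 J') ->
  {in Q (k + p.*2)%N, forall J, B J} ->
  I \in Is -> Q k I ->
  walk Is Js p I I' = walk [seq J <- Is | B J] [seq J <- Js | B J] p I I'.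
Proof.
move=> Qmono hlt Qstep QB.
have QmonoD i j : {subset Q i <= Q (i + j)%N}.
  elim: j => [|j IHj] J hJ; first by rewrite addn0.
  by rewrite addnS; apply: Qmono; exact: IHj.
elim: p k I Qstep QB => [//|p IHp] k I Qstep QB hI QI /=.
rewrite big_filter [RHS]big_mkcond /=.
apply: eq_big_seq => J hJ.
have [wIJ|wIJ] := boolP ((I.1 < J.2) && (J.1 < I.2)); last first.
  rewrite big1 => [|I'' _]; last by rewrite (weight_eq0 wIJ) ?mul0r// hlt ?hI ?hJ ?orbT.
  by case: ifP => // _; rewrite big1// => I'' _; rewrite (weight_eq0 wIJ) ?mul0r// hlt ?hI ?hJ ?orbT.
have QJ : Q k.+1 J.
  case/andP: wIJ => a b; apply: (Qstep k I J) => //; rewrite ?hI ?hJ ?orbT//.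
  by rewrite -[ltnLHS]addn0 ltn_add2l.
rewrite QB; last first.
  rewrite doubleS !addnS -addSn; have := @QmonoD k.+1 p.*2.+1 J QJ.
  by rewrite !addnS addSn.
rewrite big_filter [RHS]big_mkcond /=.
apply: eq_big_seq => I'' hI''.
have [wJI|wJI] := boolP ((I''.1 < J.2) && (J.1 < I''.2)); last first.
  have -> : weight I'' J = 0 by rewrite (weight_eq0 wJI)// hlt ?hI'' ?hJ ?orbT.
  by rewrite mulr0 !mul0r if_same.
have QI'' : Q k.+2 I''.
  case/andP: wJI => a b; apply: (Qstep k.+1 J I'') => //; rewrite ?hI'' ?hJ ?orbT//.
  by rewrite doubleS !addnS !ltnS leq_addr.
rewrite QB; last first.
  rewrite doubleS !addnS; have := @QmonoD k.+2 p.*2 I'' QI''.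
  by rewrite !addSn.
congr (_ * _); apply: (IHp k.+2) => //.
  move=> i J1 J2 hi; apply: Qstep.
  by move: hi; rewrite doubleS !addnS !addSn.
by move=> J1 h; apply: QB; rewrite doubleS !addnS; move: h; rewrite !addSn.
Qed.

End walks.

(** * Localisation of closed walks *)

Section windows.
Context {R : realType}.
Implicit Types (I J : R * R) (s : seq R) (a b x y : R).

Definition window a b s : seq R := [seq x <- s | a < x <= b].

Definition itv_in a b I : bool := (a < I.1) && (I.2 <= b).

Lemma window_sorted a b s : sorted <%R s -> sorted <%R (window a b s).
Proof. by apply: sorted_filter; exact: lt_trans. Qed.

(** Both sides list the consecutive pairs of points of the window, because the
window cuts out a contiguous stretch of the sorted list. *)
Lemma intervals_window a b s : sorted <%R s ->
  [seq I <- intervals s | itv_in a b I] = intervals (window a b s).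
Proof.
elim: s => // x [|y s] IHs ss.
  by rewrite /window/=; case: ifP.
have /andP[xy ys] := ss.
have {}IHs := IHs ys.
rewrite intervals_cons [LHS]/= IHs /itv_in /window [in RHS]/= /=.
case: ltP => //= ax.
have ay := lt_trans ax xy; rewrite ay /=.
have [yb|yb] := leP y b; first by rewrite (ltW (lt_le_trans xy yb)).
have -> : [seq x <- s | a < x <= b] = [::].
  apply/eqP; rewrite -(negbK (_ == _)) -has_filter; apply/hasPn => z zs.
  rewrite negb_and -!ltNge orbC (lt_trans yb)//.
  exact: (allP (order_path_min lt_trans ys)).
by case: ifP.
Qed.

Lemma loop_sum_local (Q : nat -> pred (R * R)) (C : pred R) a b s1 s2 p :
  sorted <%R s1 -> sorted <%R s2 ->
  (forall i, {subset Q i <= Q i.+1}) ->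
  (forall i J J', (i < p.*2)%N -> (J \in intervals s1) || (J \in intervals s2) ->
     (J' \in intervals s1) || (J' \in intervals s2) ->
     Q i J -> J.1 < J'.2 -> J'.1 < J.2 -> Q i.+1 J') ->
  {in Q p.*2, forall J, itv_in a b J} ->
  (forall I, I \in intervals s1 -> C I.2 -> Q 0%N I) ->
  loop_sum C (intervals s1) (intervals s2) p =
  loop_sum C (intervals (window a b s1)) (intervals (window a b s2)) p.
Proof.
move=> ss1 ss2 Qmono Qstep QB Q0.
rewrite /loop_sum -!intervals_window// big_filter_cond /=.
rewrite big_seq_cond [RHS]big_seq_cond [RHS]big_mkcond [LHS]big_mkcond/=.
apply: eq_bigr => I _; have [hI|//] := boolP (I \in _); rewrite /=.
have [CI|] := boolP (C I.2); last by rewrite andbF.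
have QI := Q0 _ hI CI.
have QI2 : Q p.*2 I.
  by elim: (p.*2) => // q; apply: Qmono.
rewrite (QB I QI2) /=.
apply: (walk_local (Q := Q) (k := 0)) => //.
by move=> J /orP[] /intervals_lt; apply.
Qed.

(** A walk starting to the left of e 0 moves right by at most one stretch
(e i, e i.+1] per half-step: an interval overlapping one which ends by e i
starts before e i, and the point in the next stretch stops it. *)
Lemma loop_sum_left (e : nat -> R) (C : pred R) a s1 s2 p :
  sorted <%R s1 -> sorted <%R s2 ->
  all (>%R^~ a) s1 -> all (>%R^~ a) s2 ->
  (forall i, e i <= e i.+1) ->
  (forall i, (i < p.*2)%N -> has (fun x => e i < x <= e i.+1) s1 &&
                             has (fun x => e i < x <= e i.+1) s2) ->
  (forall x, C x -> x <= e 0%N) ->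
  loop_sum C (intervals s1) (intervals s2) p =
  loop_sum C (intervals (window a (e p.*2) s1)) (intervals (window a (e p.*2) s2)) p.
Proof.
move=> ss1 ss2 /allP a1 /allP a2 emono ehas Ce.
apply: (loop_sum_local (Q := fun i I => itv_in a (e i) I)) => //.
- by move=> i I /andP[h1 h2]; apply/andP; split=> //; exact: le_trans h2 (emono i).
- move=> i J J' /ehas /andP[h1 h2] _ hJ' /andP[_ Je] _ J'J.
  have key s : sorted <%R s -> has (fun x => e i < x <= e i.+1) s -> J' \in intervals s ->
      J'.2 <= e i.+1.
    move=> ss /hasP[x xs /andP[ex xe]] J's.
    by have [|] := intervals_gap ss J's xs; lra.
  apply/andP; split.
    by case/orP: hJ' => /intervals_mem[+ _] => [/a1|/a2].
  by case/orP: hJ' => hJ'; [apply: (key s1)|apply: (key s2)].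
- move=> I hI /Ce hC; rewrite /itv_in hC andbT.
  by have /intervals_mem[+ _] := hI => /a1.
Qed.

(** Mirror image of the previous lemma.  One more stretch is needed, because the
condition on C bounds the right endpoint of the starting interval, and its left
endpoint has first to be located. *)
Lemma loop_sum_right (e : nat -> R) (C : pred R) b s1 s2 p :
  sorted <%R s1 -> sorted <%R s2 ->
  all (<=%R^~ b) s1 -> all (<=%R^~ b) s2 ->
  (forall i, e i.+1 <= e i) ->
  (forall i, (i < p.*2.+1)%N -> has (fun x => e i.+1 < x <= e i) s1 &&
                                has (fun x => e i.+1 < x <= e i) s2) ->
  (forall x, C x -> e 0%N < x) ->
  loop_sum C (intervals s1) (intervals s2) p =
  loop_sum C (intervals (window (e p.*2.+1) b s1)) (intervals (window (e p.*2.+1) b s2)) p.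
Proof.
move=> ss1 ss2 /allP b1 /allP b2 emono ehas Ce.
have key s i J : sorted <%R s -> has (fun x => e i.+1 < x <= e i) s -> J \in intervals s ->
    e i < J.2 -> e i.+1 < J.1.
  move=> ss /hasP[x xs /andP[ex xe]] Js eJ.
  by have [|] := intervals_gap ss Js xs; lra.
apply: (loop_sum_local (Q := fun i I => itv_in (e i.+1) b I)) => //.
- by move=> i I /andP[h1 h2]; apply/andP; split=> //; exact: le_lt_trans (emono _) h1.
- move=> i J J' hi _ hJ' /andP[Je _] JJ' _.
  have eJ' : e i.+1 < J'.2 by exact: lt_trans JJ'.
  have /andP[h1 h2] := ehas i.+1 hi.
  apply/andP; split; last by case/orP: hJ' => /intervals_mem[_ +] => [/b1|/b2].
  by case/orP: hJ' => hJ'; [apply: (key s1)|apply: (key s2)].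
- move=> I hI /Ce hC; have /andP[h1 h2] := ehas 0%N isT.
  apply/andP; split; first exact: (key s1).
  by have /intervals_mem[_ +] := hI => /b1.
Qed.

End windows.

(** * Traces as sums over closed walks *)

Section paths.
Context {R : realType}.
Implicit Types (S : nat -> R) (m : nat).

Definition path_points m S : seq R := [seq S i | i <- iota 0 m.+1].

Lemma intervals_path_points m S : intervals (path_points m S) = [seq (S i, S i.+1) | i <- iota 0 m].
Proof.
rewrite /path_points; elim: m 0%N => [//|m IHm] k.
by rewrite [iota k m.+2]/= !map_cons intervals_cons -IHm.
Qed.

Lemma path_points_sorted m S : (forall i, (i < m)%N -> S i < S i.+1) -> sorted <%R (path_points m S).
Proof.
rewrite /path_points => hS.
suff: forall k, (forall i, (i < m)%N -> S (k + i)%N < S (k + i).+1) ->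
   sorted <%R [seq S i | i <- iota k m.+1] by apply.
elim: {hS} m => // m IHm k hS.
have h0 := hS 0%N isT; rewrite addn0 in h0.
rewrite /= h0; apply: (IHm k.+1) => i im.
by rewrite addSnnS; apply: hS.
Qed.

Lemma sum_intervals_path_points m S (C : pred (R * R)) (F : R * R -> R) :
  \sum_(I <- intervals (path_points m S) | C I) F I =
  \sum_(i < m | C (S i, S i.+1)) F (S i, S i.+1).
Proof.
rewrite intervals_path_points big_map.
by rewrite -[X in iota 0 X]subn0 -/(index_iota 0 m) big_mkord.
Qed.

Lemma count_uptoE m S t : count_upto m S t = count (fun x => x <= t) (behead (path_points m S)).
Proof.
rewrite /count_upto /path_points /= count_map -sum1_count [RHS]big_mkcond /= /index_iota subSS subn0.
by apply: eq_bigr => i _ /=; case: (_ <= _).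
Qed.

Lemma lenE (a b : R) : a < b -> len `]a, b]%classic = b - a.
Proof. by move=> ab; rewrite /len lebesgue_measure_itv/= lte_fin ab -EFinD. Qed.

(** Degenerate intersections are the reason for the positive part in
the definition of the overlap. *)
Lemma len_overlapE (a b c d : R) : a < b -> c < d ->
  len (`]a, b]%classic `&` `]c, d]%classic) = overlap (a, b) (c, d).
Proof.
move=> ab cd; rewrite /overlap/=.
have -> : `]a, b]%classic `&` `]c, d]%classic =
    `](Num.max a c), (Num.min b d)]%classic.
  apply/seteqP; split => x /=; rewrite !in_itv/= gt_max le_min.
    by move=> [/andP[-> ->] /andP[-> ->]].
  by move=> /andP[/andP[-> ->] /andP[-> ->]].
have [h|h] := ltP (Num.max a c) (Num.min b d).
  by rewrite lenE//; apply/esym/max_idPr; rewrite subr_ge0 ltW.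
rewrite [RHS](_ : _ = 0); last by apply/max_idPl; rewrite subr_le0.
rewrite /len set_itv_ge ?measure0//.
by rewrite bnd_simp -leNgt.
Qed.

Lemma sup_inE S a b i : S i < S i.+1 -> sup_in S a b i.+1 = (a < S i.+1 <= b).
Proof. by move=> h; rewrite /sup_in /obs_itv sup_itv/= ?bnd_simp// in_itv. Qed.

Lemma block_countE m S a b : (forall i, (i < m)%N -> S i < S i.+1) ->
  (block_count m S a b)%:R =
  loop_sum (fun x => a < x <= b) (intervals (path_points m S)) (intervals (path_points m S)) 0.
Proof.
move=> hS.
rewrite /block_count /loop_sum sum_intervals_path_points.
rewrite -sum1_card natr_sum; apply: eq_big => i /=.
  by rewrite inE sup_inE // hS.
by rewrite weight_diag //= hS.
Qed.

Lemma count_upto_incr m S t1 t2 : S 0%N = 0 -> 0 <= t1 -> t1 <= t2 ->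
  (count_upto m S t2)%:R - (count_upto m S t1)%:R =
  (count (fun x => t1 < x <= t2) (path_points m S))%:R :> R.
Proof.
move=> S0 t10 t12; rewrite !count_uptoE.
have -> : count (fun x => t1 < x <= t2) (path_points m S) =
   count (fun x => t1 < x <= t2) (behead (path_points m S)).
  by rewrite /path_points /= S0 ltNge t10.
move: (behead (path_points m S)) => s.
suff -> : count (fun x => x <= t2) s =
    (count (fun x => (x <= t1)%R) s + count (fun x => (t1 < x <= t2)%R) s)%N.
  by rewrite natrD addrC addKr.
elim: s => //= x s ->; rewrite addnACA; congr (_ + _)%N.
have [xt|xt] /= := leP x t1; first by rewrite (le_trans xt t12).
by [].
Qed.

Variables (m1 m2 : nat) (S1 S2 : nat -> R).
Hypothesis hS1 : forall i, (i < m1)%N -> S1 i < S1 i.+1.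
Hypothesis hS2 : forall i, (i < m2)%N -> S2 i < S2 i.+1.

Lemma overlap_mxE i j :
  overlap_mx m1 m2 S1 S2 i j = weight (S1 i, S1 i.+1) (S2 j, S2 j.+1).
Proof.
have h1 := hS1 (ltn_ord i); have h2 := hS2 (ltn_ord j).
by rewrite mxE /obs_itv /= len_overlapE// !lenE.
Qed.

(** The identity matrix is matched with the weights because distinct
intervals of the subdivision have overlap 0. *)
Lemma overlap_powE p (i j : 'I_m1) :
  let G := overlap_mx m1 m2 S1 S2 in
  ((G *m G^T) ^+ p) i j =
  walk (intervals (path_points m1 S1)) (intervals (path_points m2 S2)) p (S1 i, S1 i.+1) (S1 j, S1 j.+1).
Proof.
move=> G; elim: p i => [|p IHp] i.
  rewrite expr0 mxE /=; case: eqP => [->|ij]; first by rewrite weight_diag// hS1.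
  have ss := path_points_sorted hS1.
  have mem (k : 'I_m1) : (S1 k, S1 k.+1) \in intervals (path_points m1 S1).
    by rewrite intervals_path_points; apply/mapP; exists (val k) => //; rewrite mem_iota /= add0n.
  rewrite (intervals_disj ss)//.
  apply/negP => /eqP[eqS _]; apply: ij; apply: val_inj => /=.
  have us : uniq (path_points m1 S1) by apply: sorted_uniq ss; [exact: lt_trans|exact: ltxx].
  have := us; rewrite /path_points => /mkseq_uniqP; apply => //; rewrite inE ltnS ltnW//.
rewrite exprS mxE /= sum_intervals_path_points.
under eq_bigr => k _ do rewrite IHp mxE mulr_suml.
rewrite exchange_big /=; apply: eq_bigr => k _.
rewrite sum_intervals_path_points; apply: eq_bigr => l _.
by rewrite [G^T _ _]mxE /G !overlap_mxE.
Qed.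

Lemma block_traceE p a b : block_trace m1 m2 S1 S2 p a b =
  loop_sum (fun x => a < x <= b) (intervals (path_points m1 S1)) (intervals (path_points m2 S2)) p.
Proof.
rewrite /block_trace /mxtrace /loop_sum sum_intervals_path_points.
rewrite [RHS]big_mkcond /=; apply: eq_bigr => i _.
rewrite /block_diag mul_diag_mx !mxE sup_inE ?hS1// overlap_powE.
by case: ifP => _; rewrite ?mul1r ?mul0r.
Qed.

End paths.

(** * Measurability of windowed traces *)

Section measurability.
Context {R : realType} {d : measure_display} {T : measurableType d}.

Lemma measurable_fun_of_le (f : T -> R) :
  (forall t, measurable [set w | f w <= t]) -> measurable_fun setT f.
Proof.
move=> mf; apply: (measurability _ (RGenOInfty.measurableE R)) => //.
move=> _ [_ [t ->] <-]; rewrite setTI.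
rewrite [X in measurable X](_ : _ = ~` [set w | f w <= t]).
  exact: measurableC.
by apply/seteqP; split => w /=; rewrite in_itv/= andbT ltNge => /negP.
Qed.

Lemma measurable_fun_natP (f : T -> nat) :
  (forall k, measurable [set w | f w = k]) -> measurable_fun setT f.
Proof.
move=> mf _ Y _; rewrite setTI.
rewrite (_ : f @^-1` Y = \bigcup_(k in Y) [set w | f w = k]).
  by apply: bigcup_measurable => k _; exact: mf.
by apply/seteqP; split => [w Yw|w [k Yk /= ->]]; [exists (f w)|].
Qed.

Lemma measurable_fun_natr (f : T -> nat) :
  measurable_fun setT (fun w => (f w)%:R : R) -> measurable_fun setT f.
Proof.
move=> mf; apply: measurable_fun_natP => k.
rewrite (_ : [set w | _] = (fun w => (f w)%:R : R) @^-1` [set k%:R]).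
  by rewrite -[X in measurable X]setTI; apply: mf => //; exact: measurable_set1.
by apply/seteqP; split => w /= [] => [->//|/eqP]; rewrite eqr_nat => /eqP.
Qed.

(** On each of the countably many events K = k a measurable formula is
available, although the formula depends on k. *)
Lemma measurable_fun_glue (K : T -> nat) (f : T -> R) (g : nat -> T -> R) :
  measurable_fun setT K -> (forall k, measurable_fun setT (g k)) ->
  (forall w, f w = g (K w) w) -> measurable_fun setT f.
Proof.
move=> mK mg fg _ Y mY; rewrite setTI.
rewrite (_ : f @^-1` Y = \bigcup_k ((K @^-1` [set k]) `&` (g k @^-1` Y))).
  apply: bigcup_measurable => k _; apply: measurableI.
    by rewrite -[X in measurable X]setTI; exact: mK.
  by rewrite -[X in measurable X]setTI; exact: mg.
apply/seteqP; split => [w /= Yw|w [k _ /= [<-]]]; last by rewrite -fg.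
by exists (K w) => //=; rewrite -fg.
Qed.

(** Inversion is the power -1 on nonnegative numbers, and odd. *)
Lemma measurable_fun_invr (f : T -> R) :
  measurable_fun setT f -> measurable_fun setT (fun w => (f w)^-1).
Proof.
move=> mf.
rewrite (_ : (fun w => (f w)^-1) =
  (fun w => if f w < 0 then - ((- f w) `^ (-1)) else f w `^ (-1))).
  apply: measurable_fun_ifT.
  - exact: measurable_fun_ltr.
  - apply: measurable_funN.
    apply: (measurableT_comp (measurable_powR (-1))).
    exact: measurable_funN.
  - exact: (measurableT_comp (measurable_powR (-1))).
apply/funext => w; case: ltP => h.
  by rewrite powR_inv1 ?invrN ?opprK// oppr_ge0 ltW.
by rewrite powR_inv1.
Qed.

Lemma measurable_fun_sqrtr (f : T -> R) :
  measurable_fun setT f -> measurable_fun setT (fun w => Num.sqrt (f w)).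
Proof.
move=> mf; rewrite (_ : (fun w => _) = Num.sqrt \o f)//.
apply: measurableT_comp => //.
by apply: continuous_measurable_fun; exact: sqrt_continuous.
Qed.

Section fixed_size.
Variables (u v : nat -> T -> R).
Hypotheses (mu : forall r, measurable_fun setT (u r))
           (mv : forall r, measurable_fun setT (v r)).

Lemma measurable_weight (a b c e : T -> R) :
  measurable_fun setT a -> measurable_fun setT b ->
  measurable_fun setT c -> measurable_fun setT e ->
  measurable_fun setT (fun w => weight (a w, b w) (c w, e w)).
Proof.
move=> ma mb mc me; apply: measurable_funM.
  apply: measurable_maxr => //; apply: measurable_funB.
    exact: measurable_minr.
  exact: measurable_maxr.
apply: measurable_fun_invr; apply: measurable_funM;
  by apply: measurable_fun_sqrtr; exact: measurable_funB.
Qed.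

Definition steps (f : nat -> T -> R) k w := [seq (f r w, f r.+1 w) | r <- iota 0 k].

Lemma measurable_walk k l p i j :
  measurable_fun setT (fun w => walk (steps u k w) (steps v l w) p
     (u i w, u i.+1 w) (u j w, u j.+1 w)).
Proof.
elim: p i => [|p IHp] i /=; first exact: measurable_weight.
under eq_fun => w.
  rewrite big_map; under eq_bigr do rewrite big_map.
  over.
apply: measurable_sum => r; apply: measurable_sum => q.
by apply: measurable_funM => //; apply: measurable_funM; exact: measurable_weight.
Qed.

Lemma measurable_loop_sum_steps k l p (x y : R) :
  measurable_fun setT (fun w =>
    loop_sum (fun z => x < z <= y) (steps u k w) (steps v l w) p).
Proof.
rewrite /loop_sum; under eq_fun do rewrite big_map big_mkcond /=.
apply: measurable_sum => r; apply: measurable_fun_ifT => //.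
  by apply: measurable_and; [exact: measurable_fun_ltr|exact: measurable_fun_ler].
exact: measurable_walk.
Qed.

End fixed_size.

Lemma intervals_nth (b : R) (L : seq R) :
  intervals L = [seq (nth b L r, nth b L r.+1) | r <- iota 0 (size L).-1].
Proof.
case: L => // x L; rewrite -[in LHS](mkseq_nth b (x :: L)) /=.
exact: (intervals_path_points (size L) (nth b (x :: L))).
Qed.

(** The analogue, inside a window, of the duality between arrival times and
counts.  The default value b of nth makes it hold for all ranks r. *)
Lemma nth_window_le (a b t : R) s r : sorted <%R s -> a <= t -> t < b ->
  (nth b (window a b s) r <= t) = (r < count (fun x => (a < x <= t)%R) s)%N.
Proof.
move=> ss at_ tb.
have ssw : sorted <=%R (window a b s).
  by apply: (@sub_sorted _ <%R) (window_sorted a b ss) => x y /ltW.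
have -> : count (fun x => a < x <= t) s = count (fun x => x <= t) (window a b s).
  rewrite /window count_filter; apply: eq_count => x /=.
  by case: (leP x t) => // xt; rewrite ?andbF//= (ltW (le_lt_trans xt tb)) andbT.
have [h|h] := ltnP r (count _ _); first by rewrite nth_count_le.
have [hr|hr] := ltnP r (size (window a b s)); last first.
  by rewrite nth_default// leNgt tb.
by apply/negbTE; rewrite -ltNge nth_count_gt// h hr.
Qed.

Section window_points.
Variables (a b : R) (s : T -> seq R).
Hypotheses (ab : a <= b) (ss : forall w, sorted <%R (s w)).
Hypothesis ms : forall t, a <= t <= b ->
  measurable_fun setT (fun w => count (fun x => a < x <= t) (s w)).

Lemma measurable_size_window : measurable_fun setT (fun w => size (window a b (s w))).
Proof.
by under eq_fun do rewrite size_filter; apply: ms; rewrite ab lexx.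
Qed.

Lemma measurable_nth_window r : measurable_fun setT (fun w => nth b (window a b (s w)) r).
Proof.
apply: measurable_fun_of_le => t.
have [bt|tb] := leP b t.
  rewrite (_ : [set w | _] = setT)//; apply/seteqP; split => // w _ /=.
  apply: le_trans bt; have [h|h] := ltnP r (size (window a b (s w))).
    by have := mem_nth b h; rewrite mem_filter => /andP[/andP[]].
  by rewrite nth_default.
have [at_|ta] := leP a t.
  rewrite (_ : [set w | _] = (fun w => count (fun x => a < x <= t) (s w)) @^-1` [set k | (r < k)%N]).
    by rewrite -[X in measurable X]setTI; apply: ms => //; rewrite at_ ltW.
  by apply/seteqP; split => w /=; rewrite nth_window_le.
rewrite (_ : [set w | _] = set0)//; apply/seteqP; split => // w /=.
apply/negP; rewrite -ltNge; have [h|h] := ltnP r (size (window a b (s w))).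
  by have := mem_nth b h; rewrite mem_filter => /andP[/andP[+ _] _]; exact: lt_trans.
by rewrite nth_default.
Qed.

End window_points.

(** Only the counts on initial parts of the window enter the hypotheses, so the
lemma applies to any sigma-algebra for which these are measurable, in particular
to the one generated by the increments over the window. *)
Lemma measurable_loop_sum (a b : R) (s1 s2 : T -> seq R) p (x y : R) :
  a <= b -> (forall w, sorted <%R (s1 w)) -> (forall w, sorted <%R (s2 w)) ->
  (forall t, a <= t <= b ->
     measurable_fun setT (fun w => count (fun z => a < z <= t) (s1 w))) ->
  (forall t, a <= t <= b ->
     measurable_fun setT (fun w => count (fun z => a < z <= t) (s2 w))) ->
  measurable_fun setT (fun w => loop_sum (fun z => x < z <= y)
    (intervals (window a b (s1 w))) (intervals (window a b (s2 w))) p).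
Proof.
move=> ab ss1 ss2 ms1 ms2.
pose u r w := nth b (window a b (s1 w)) r; pose v r w := nth b (window a b (s2 w)) r.
apply: (measurable_fun_glue (measurable_size_window ab ms1)
  (g := fun k w => loop_sum (fun z => x < z <= y) (steps u k.-1 w)
    (intervals (window a b (s2 w))) p)) => [k|w]; last by rewrite /= /steps -intervals_nth.
apply: (measurable_fun_glue (measurable_size_window ab ms2)
  (g := fun l w => loop_sum (fun z => x < z <= y) (steps u k.-1 w)
    (steps v l.-1 w) p)) => [l|w]; last by rewrite /= /steps -intervals_nth.
by apply: measurable_loop_sum_steps => r; apply: measurable_nth_window.
Qed.

End measurability.

(** * Expectation and covariance *)

Section expect.
Context {d : measure_display} {T : measurableType d} {R : realType}.
Variable P : probability T R.
Implicit Types (X Y Z : T -> R) (A B : set T).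

Definition L1 X := P.-integrable setT (EFin \o X).
Definition Ex X : R := \int[P]_w X w.
Definition pr A : R := fine (P A).

Lemma prE A : measurable A -> P A = (pr A)%:E.
Proof. by move=> mA; rewrite /pr fineK// fin_num_measure. Qed.

Lemma L1_measurable X : L1 X -> measurable_fun setT X.
Proof. by move=> /measurable_int/measurable_EFinP. Qed.

Lemma L1_le Z X : measurable_fun setT X -> (forall w, `|X w| <= Z w) -> L1 Z -> L1 X.
Proof.
move=> mX XZ; apply: le_integrable => //; first exact/measurable_EFinP.
by move=> w _ /=; rewrite lee_fin (le_trans (XZ w))// ler_norm.
Qed.

Lemma L1_cst (k : R) : L1 (fun _ => k).
Proof. exact: finite_measure_integrable_cst. Qed.

Lemma L1_bounded k X : measurable_fun setT X -> (forall w, `|X w| <= k) -> L1 X.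
Proof. by move=> mX Xk; apply: (L1_le mX Xk); exact: L1_cst. Qed.

Lemma L1D X Y : L1 X -> L1 Y -> L1 (fun w => X w + Y w).
Proof. by move=> hX hY; apply: (integrableD measurableT hX hY). Qed.

Lemma L1B X Y : L1 X -> L1 Y -> L1 (fun w => X w - Y w).
Proof. by move=> hX hY; apply: (integrableB measurableT hX hY). Qed.

Lemma L1Z k X : L1 X -> L1 (fun w => k * X w).
Proof. by move=> hX; apply: (integrableZl measurableT k hX). Qed.

Lemma L1_abs X : L1 X -> L1 (fun w => `|X w|).
Proof. by move=> hX; apply: (integrable_norm hX). Qed.

Lemma L1_sum (I : Type) (r : seq I) (Q : pred I) (F : I -> T -> R) :
  (forall i, L1 (F i)) -> L1 (fun w => \sum_(i <- r | Q i) F i w).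
Proof.
move=> hF; elim: r => [|i r IHr].
  by under eq_fun do rewrite big_nil; exact: L1_cst.
under eq_fun do rewrite big_cons.
by case: (Q i) => //; exact: L1D.
Qed.

Lemma ExD X Y : L1 X -> L1 Y -> Ex (fun w => X w + Y w) = Ex X + Ex Y.
Proof. by move=> hX hY; apply: RintegralD. Qed.

Lemma ExB X Y : L1 X -> L1 Y -> Ex (fun w => X w - Y w) = Ex X - Ex Y.
Proof. by move=> hX hY; apply: RintegralB. Qed.

Lemma ExZ k X : L1 X -> Ex (fun w => k * X w) = k * Ex X.
Proof. by move=> hX; apply: RintegralZl. Qed.

Lemma Ex_cst k : Ex (fun _ => k) = k.
Proof. by rewrite /Ex Rintegral_cst// (congr1 fine (probability_setT P)) mulr1. Qed.

Lemma Ex_le X Y : L1 X -> L1 Y -> (forall w, X w <= Y w) -> Ex X <= Ex Y.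
Proof. by move=> hX hY h; apply: le_Rintegral => // w _; apply: h. Qed.

Lemma Ex_ge0 X : (forall w, 0 <= X w) -> 0 <= Ex X.
Proof. by move=> h; apply: Rintegral_ge0 => w _; apply: h. Qed.

Lemma Ex_norm X : L1 X -> `|Ex X| <= Ex (fun w => `|X w|).
Proof. by move=> hX; apply: le_normr_Rintegral. Qed.

Lemma Ex_sum (I : Type) (r : seq I) (Q : pred I) (F : I -> T -> R) :
  (forall i, L1 (F i)) ->
  Ex (fun w => \sum_(i <- r | Q i) F i w) = \sum_(i <- r | Q i) Ex (F i).
Proof.
move=> hF; elim: r => [|i r IHr].
  by under [X in Ex X]eq_fun do rewrite big_nil; rewrite Ex_cst big_nil.
under [X in Ex X]eq_fun do rewrite big_cons.
by rewrite big_cons; case: (Q i) => //; rewrite ExD ?IHr//; exact: L1_sum.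
Qed.

Lemma L1_indic A : measurable A -> L1 (\1_A).
Proof.
move=> mA; apply: (@L1_bounded 1); first exact: measurable_indic.
by move=> w; rewrite indicE; case: (_ \in _); rewrite ?normr1 ?normr0.
Qed.

Lemma Ex_indic A : measurable A -> Ex (\1_A) = pr A.
Proof. by move=> mA; rewrite /Ex /Rintegral integral_indic// setIT. Qed.

Lemma pr_ge0 A : 0 <= pr A.
Proof. exact: fine_ge0. Qed.

Lemma pr_le1 A : measurable A -> pr A <= 1.
Proof. by move=> mA; rewrite -lee_fin -prE// probability_le1. Qed.

Lemma markov_ineq X (e : R) : 0 < e -> L1 X -> (forall w, 0 <= X w) ->
  pr [set w | e < X w] <= Ex X / e.
Proof.
move=> e0 LX X0.
have mA : measurable [set w | e < X w].
  rewrite -[X in measurable X]setTI; apply: (measurable_fun_ltr (f := fun=> e)) => //.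
  exact: L1_measurable.
rewrite ler_pdivlMr// -Ex_indic// mulrC -ExZ; last exact: L1_indic.
apply: Ex_le => //; first by apply: L1Z; exact: L1_indic.
move=> w; rewrite indicE; case: (boolP (_ \in _)); last by rewrite mulr0.
by rewrite inE /= => /ltW; rewrite mulr1.
Qed.

Lemma markov_sq X (e : R) : 0 < e -> L1 (fun w => X w ^+ 2) ->
  pr [set w | e < `|X w|] <= Ex (fun w => X w ^+ 2) / e ^+ 2.
Proof.
move=> e0 LX.
rewrite (_ : [set w | e < `|X w|] = [set w | e ^+ 2 < X w ^+ 2]).
  by apply: markov_ineq; rewrite ?exprn_gt0// => w; exact: sqr_ge0.
have sqE w : (e < `|X w|) = (e ^+ 2 < X w ^+ 2).
  by rewrite -[X w ^+ 2]real_normK ?num_real// ltr_pXn2r// nnegrE ltW.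
by apply/seteqP; split => w /=; rewrite sqE.
Qed.

Definition cov X Y : R := Ex (fun w => X w * Y w) - Ex X * Ex Y.

Lemma covC X Y : cov X Y = cov Y X.
Proof. by rewrite /cov mulrC; congr (Ex _ - _); apply/funext => w; rewrite mulrC. Qed.

Lemma chebyshev_sum (I : eqType) (r : seq I) (F : I -> T -> R) (V e : R) :
  0 < e -> (forall i, L1 (F i)) -> (forall i j, L1 (fun w => F i w * F j w)) ->
  \sum_(i <- r) \sum_(j <- r) cov (F i) (F j) <= V ->
  pr [set w | e < `|\sum_(i <- r) F i w - Ex (fun w => \sum_(i <- r) F i w)|] <=
    V / e ^+ 2.
Proof.
move=> e0 hF hFF hV.
set S := fun w => \sum_(i <- r) F i w.
have S2E : (fun w => S w ^+ 2) =
    (fun w => \sum_(i <- r) \sum_(j <- r) F i w * F j w).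
  by apply/funext => w; rewrite expr2 /S mulr_suml; apply: eq_bigr => i _; rewrite mulr_sumr.
have LS : L1 S by exact: L1_sum.
have LS2 : L1 (fun w => S w ^+ 2).
  by rewrite S2E; apply: L1_sum => i; exact: L1_sum.
have E2 : (fun w => (S w - Ex S) ^+ 2) =
    (fun w => (S w ^+ 2 - (2 * Ex S) * S w) + (Ex S) ^+ 2).
  by apply/funext => w; ring.
have LS' : L1 (fun w => S w ^+ 2 - (2 * Ex S) * S w).
  by apply: L1B => //; exact: L1Z.
apply: (le_trans (markov_sq e0 _)).
  by rewrite E2; apply: L1D => //; exact: L1_cst.
rewrite ler_wpM2r ?invr_ge0 ?sqr_ge0//.
apply: le_trans hV; rewrite E2 ExD//; last exact: L1_cst.
rewrite ExB//; last exact: L1Z.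
rewrite ExZ// Ex_cst.
suff -> : \sum_(i <- r) \sum_(j <- r) cov (F i) (F j) =
    Ex (fun w => S w ^+ 2) - Ex S * Ex S by lra.
rewrite S2E Ex_sum; last by move=> i; exact: L1_sum.
rewrite /S Ex_sum// mulr_suml -sumrB; apply: eq_bigr => i _.
by rewrite Ex_sum// mulr_sumr -sumrB.
Qed.

Lemma cov_le U V : L1 U -> L1 V -> L1 (fun w => U w * V w) ->
  `|cov U V| <= Ex (fun w => `|U w| * `|V w|) + Ex (fun w => `|U w|) * Ex (fun w => `|V w|).
Proof.
move=> hU hV hUV; apply: le_trans (ler_normB _ _) _; apply: lerD.
  apply: le_trans (Ex_norm hUV) _.
  by under eq_fun do rewrite normrM.
by rewrite normrM ler_pM// Ex_norm.
Qed.

(** Bilinearity, arranged for replacing first X and then Y. *)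
Lemma cov_perturb X Y X' Y' :
  L1 X -> L1 Y -> L1 X' -> L1 Y' ->
  L1 (fun w => X w * Y w) -> L1 (fun w => X' w * Y w) -> L1 (fun w => X' w * Y' w) ->
  cov X Y = cov X' Y' + (cov (fun w => X w - X' w) Y + cov X' (fun w => Y w - Y' w)).
Proof.
move=> hX hY hX' hY' hXY hX'Y hX'Y'; rewrite /cov.
have -> : (fun w => (X w - X' w) * Y w) = (fun w => X w * Y w - X' w * Y w).
  by apply/funext => w; ring.
have -> : (fun w => X' w * (Y w - Y' w)) = (fun w => X' w * Y w - X' w * Y' w).
  by apply/funext => w; ring.
by rewrite !ExB//; ring.
Qed.

End expect.

(** * Covariance of bounded variables under mixing *)

Section levels.
Context {R : realType}.

(** Staircase with steps of height dl.  It is a sum of indicators of superlevel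
sets, for which covariances are differences of probabilities. *)
Definition level (dl : R) (N : nat) (x : R) : R :=
  \sum_(m < N) dl * (dl * m.+1%:R <= x)%R%:R.

Lemma level_bounds dl N x : 0 <= dl -> 0 <= x ->
  (dl * N%:R <= x -> level dl N x = dl * N%:R) /\
  (x < dl * N%:R -> x - dl <= level dl N x <= x).
Proof.
move=> dl0 x0; rewrite /level; elim: N => [|N [IH1 IH2]].
  by rewrite mulr0 big_ord0; split=> //; rewrite ltNge x0.
rewrite big_ord_recr /= -natr1 mulrDr mulr1.
have [h|h] := leP (dl * N%:R + dl) x.
  split=> // _; rewrite IH1; last by lra.
  by rewrite mulr1.
split=> // _; rewrite mulr0 addr0.
have [h'|h'] := leP (dl * N%:R) x; last exact: IH2.
by rewrite IH1//; lra.
Qed.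

Lemma level_approx A N x : (0 < N)%N -> 0 <= x -> x <= A ->
  x - A / N%:R <= level (A / N%:R) N x <= x.
Proof.
move=> N0 x0 xA.
have N0' : N%:R != 0 :> R by rewrite pnatr_eq0 -lt0n.
have dl0 : 0 <= A / N%:R by rewrite divr_ge0// (le_trans x0).
have [h1 h2] := @level_bounds (A / N%:R) N x dl0 x0.
have AN : A / N%:R * N%:R = A by rewrite mulfVK.
rewrite AN in h1 h2.
have [h|h] := leP A x; last exact: h2.
rewrite (h1 h); lra.
Qed.

End levels.

Section mixing.
Context {d : measure_display} {T : measurableType d} {R : realType}.
Variable P : probability T R.
Implicit Types (X Y : T -> R).
Notation L1 := (L1 P). Notation Ex := (Ex P). Notation pr := (pr P).
Notation cov := (cov P).

(** Replacing the variables by staircases with N steps changes the covariance by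
O(1/N), and the covariance of the staircases is A^2 times an average of N^2
differences, each of which is bounded by the mixing coefficient. *)
Lemma cov_bounded_mixing (F G : set (set T)) (al A : R) X Y :
  F `<=` measurable -> G `<=` measurable ->
  (forall B C, F B -> G C -> `|pr (B `&` C) - pr B * pr C| <= al) ->
  (forall c, F [set w | c <= X w]) -> (forall c, G [set w | c <= Y w]) ->
  measurable_fun setT X -> measurable_fun setT Y ->
  (forall w, 0 <= X w <= A) -> (forall w, 0 <= Y w <= A) ->
  `|cov X Y| <= A ^+ 2 * al.
Proof.
move=> Fm Gm mix FX GY mX mY X0A Y0A.
have A0 : 0 <= A by have /andP[] := X0A point; exact: le_trans.
have bnd (Z : T -> R) : measurable_fun setT Z -> (forall w, 0 <= Z w <= A) -> L1 Z.
  move=> mZ hZ; apply: (@L1_bounded _ _ _ _ A) => // w.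
  by have /andP[h1 h2] := hZ w; rewrite ger0_norm.
suff main : forall N, (0 < N)%N -> `|cov X Y| <= A ^+ 2 * al + 4 * A ^+ 2 / N%:R.
  apply/ler_addgt0Pr => e e0.
  have x0 : 0 <= 4 * A ^+ 2 / e by rewrite divr_ge0 ?(ltW e0)// mulr_ge0// sqr_ge0.
  have hN := archi_boundP x0; set N := Num.bound _ in hN.
  apply: le_trans (main N.+1 isT) _; rewrite lerD2l ler_pdivrMr//.
  rewrite -ler_pdivrMl// mulrC (le_trans (ltW hN))// ler_nat.
  exact: leqnSn.
move=> N N0; set dl := A / N%:R.
have N0' : N%:R != 0 :> R by rewrite pnatr_eq0 -lt0n.
have dl0 : 0 <= dl by rewrite divr_ge0.
pose lX w := level dl N (X w); pose lY w := level dl N (Y w).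
have mlev (Z : T -> R) : measurable_fun setT Z -> measurable_fun setT (fun w => level dl N (Z w)).
  move=> mZ; apply: measurable_sum => m; apply: measurable_funM => //.
  rewrite (_ : (fun w => _) = \1_[set w | dl * m.+1%:R <= Z w]).
    apply: measurable_indic; rewrite -[X in measurable X]setTI.
    exact: (measurable_fun_ler (f := fun=> _)).
  by apply/funext => w; rewrite indicE mem_setE.
have aX w : X w - dl <= lX w <= X w by have /andP[? ?] := X0A w; exact: level_approx.
have aY w : Y w - dl <= lY w <= Y w by have /andP[? ?] := Y0A w; exact: level_approx.
have lge (Z : T -> R) w : 0 <= level dl N (Z w).
  by apply: sumr_ge0 => m _; rewrite mulr_ge0.
have lX0A w : 0 <= lX w <= A by have := X0A w; have := aX w; have := lge X w; rewrite -/(lX w); lra.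
have lY0A w : 0 <= lY w <= A by have := Y0A w; have := aY w; have := lge Y w; rewrite -/(lY w); lra.
have mlX := mlev _ mX; have mlY := mlev _ mY; rewrite -/lX -/lY in mlX mlY.
have LX := bnd _ mX X0A; have LY := bnd _ mY Y0A.
have LlX := bnd _ mlX lX0A; have LlY := bnd _ mlY lY0A.
have bnd2 (Z W : T -> R) : measurable_fun setT Z -> measurable_fun setT W ->
    (forall w, 0 <= Z w <= A) -> (forall w, 0 <= W w <= A) -> L1 (fun w => Z w * W w).
  move=> mZ mW hZ hW; apply: (@L1_bounded _ _ _ _ (A * A)); first exact: measurable_funM.
  move=> w; have /andP[? ?] := hZ w; have /andP[? ?] := hW w.
  by rewrite ger0_norm ?mulr_ge0// ler_pM.
rewrite (cov_perturb (X' := lX) (Y' := lY))//; [|exact: bnd2..].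
have small (U V : T -> R) : L1 U -> L1 V -> L1 (fun w => U w * V w) ->
    (forall w, 0 <= U w <= dl) -> (forall w, 0 <= V w <= A) ->
    `|cov U V| <= 2 * (dl * A).
  move=> hU hV hUV U0 V0; apply: le_trans (cov_le hU hV hUV) _.
  under eq_fun => w do rewrite ger0_norm ?(proj1 (andP (U0 w)))// ger0_norm ?(proj1 (andP (V0 w)))//.
  under [X in _ + Ex X * _]eq_fun => w do rewrite ger0_norm ?(proj1 (andP (U0 w)))//.
  under [X in _ + _ * Ex X]eq_fun => w do rewrite ger0_norm ?(proj1 (andP (V0 w)))//.
  have -> : 2 * (dl * A) = Ex (fun=> dl * A) + Ex (fun=> dl) * Ex (fun=> A).
    by rewrite !Ex_cst; ring.
  apply: lerD.
    apply: Ex_le => //; first exact: L1_cst.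
    by move=> w; have /andP[? ?] := U0 w; have /andP[? ?] := V0 w; rewrite ler_pM.
  apply: ler_pM; first by apply: Ex_ge0 => w; case/andP: (U0 w).
  - by apply: Ex_ge0 => w; case/andP: (V0 w).
  - by apply: Ex_le => //; [exact: L1_cst|move=> w; case/andP: (U0 w)].
  - by apply: Ex_le => //; [exact: L1_cst|move=> w; case/andP: (V0 w)].
have s1 : `|cov (fun w => X w - lX w) Y| <= 2 * (dl * A).
  apply: small => //; first exact: L1B.
    apply: (@L1_bounded _ _ _ _ (A * A)).
      by apply: measurable_funM => //; exact: measurable_funB.
    move=> w; have /andP[? ?] := X0A w; have /andP[? ?] := Y0A w.
    have /andP[? ?] := lX0A w.
    rewrite normrM ler_pM// ler_norml; lra.
  by move=> w; have := aX w; lra.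
have s2 : `|cov lX (fun w => Y w - lY w)| <= 2 * (dl * A).
  rewrite covC; apply: small => //; first exact: L1B.
    apply: (@L1_bounded _ _ _ _ (A * A)).
      by apply: measurable_funM => //; exact: measurable_funB.
    move=> w; have /andP[? ?] := Y0A w; have /andP[? ?] := lX0A w.
    have /andP[? ?] := lY0A w.
    rewrite normrM ler_pM// ler_norml; lra.
  by move=> w; have := aY w; lra.
have s3 : `|cov lX lY| <= A ^+ 2 * al.
  pose BX m := [set w | dl * m%:R <= X w]; pose BY m := [set w | dl * m%:R <= Y w].
  have mBX m : measurable (BX m) by exact/Fm/FX.
  have mBY m : measurable (BY m) by exact/Gm/GY.
  have lXE : lX = (fun w => \sum_(m < N) dl * \1_(BX m.+1) w).
    by apply/funext => w; apply: eq_bigr => m _; rewrite indicE mem_setE.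
  have lYE : lY = (fun w => \sum_(m < N) dl * \1_(BY m.+1) w).
    by apply/funext => w; apply: eq_bigr => m _; rewrite indicE mem_setE.
  have E1 : (fun w => lX w * lY w) =
     (fun w => \sum_(m < N) \sum_(k < N) dl ^+ 2 * \1_(BX m.+1 `&` BY k.+1) w).
    apply/funext => w; rewrite lXE lYE mulr_suml; apply: eq_bigr => m _.
    rewrite mulr_sumr; apply: eq_bigr => k _.
    by rewrite indicI /=; ring.
  have LI B : measurable B -> forall k : R, L1 (fun w => k * \1_B w).
    by move=> mB k; apply: L1Z; exact: L1_indic.
  have mI m k : measurable (BX m `&` BY k) by exact: measurableI.
  have -> : cov lX lY = \sum_(m < N) \sum_(k < N)
      dl ^+ 2 * (pr (BX m.+1 `&` BY k.+1) - pr (BX m.+1) * pr (BY k.+1)).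
    rewrite /cov E1 Ex_sum; last by move=> m; apply: L1_sum => k; exact: LI.
    rewrite lXE lYE !Ex_sum; [|by move=> m; exact: LI..].
    rewrite mulr_suml -sumrB; apply: eq_bigr => m _.
    rewrite Ex_sum; last by move=> k; exact: LI.
    rewrite mulr_sumr -sumrB; apply: eq_bigr => k _.
    by rewrite !ExZ ?Ex_indic//; [ring|exact: L1_indic..].
  apply: le_trans (ler_norm_sum _ _ _) _.
  apply: le_trans (_ : \sum_(m < N) \sum_(k < N) dl ^+ 2 * al <= _).
    apply: ler_sum => m _; apply: le_trans (ler_norm_sum _ _ _) _.
    apply: ler_sum => k _; rewrite normrM ger0_norm ?sqr_ge0//.
    by rewrite ler_wpM2l ?sqr_ge0// mix//; [exact: FX|exact: GY].
  rewrite !sumr_const !card_ord -[X in X <= _]mulr_natr -[_ *+ N]mulr_natr.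
  suff -> : A = dl * N%:R by rewrite le_eqVlt; apply/orP; left; apply/eqP; ring.
  by rewrite /dl mulfVK.
have -> : 4 * A ^+ 2 / N%:R = 2 * (dl * A) + 2 * (dl * A) by rewrite /dl; field.
apply: le_trans (ler_normD _ _) _; apply: lerD => //.
by apply: le_trans (ler_normD _ _) _; apply: lerD.
Qed.

End mixing.

(** * Covariance of approximately local variables *)

Section local_mixing.
Context {d : measure_display} {T : measurableType d} {R : realType}.
Variable P : probability T R.
Implicit Types (X Y U V W Z N : T -> R).
Notation L1 := (L1 P). Notation Ex := (Ex P). Notation pr := (pr P).
Notation cov := (cov P).

Lemma cov_dom U V Z ZU ZV :
  measurable_fun setT U -> measurable_fun setT V -> L1 Z -> L1 ZU -> L1 ZV ->
  (forall w, `|U w| * `|V w| <= Z w) -> (forall w, `|U w| <= ZU w) ->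
  (forall w, `|V w| <= ZV w) ->
  `|cov U V| <= Ex Z + Ex ZU * Ex ZV.
Proof.
move=> mU mV LZ LZU LZV hZ hU hV.
have LU := L1_le mU hU LZU; have LV := L1_le mV hV LZV.
have LUV : L1 (fun w => U w * V w).
  by apply: L1_le LZ; [exact: measurable_funM|move=> w; rewrite normrM].
apply: le_trans (cov_le LU LV LUV) _; apply: lerD.
  apply: Ex_le => //; apply: L1_le LZ => [|w]; last by rewrite normrM !normr_id.
  by apply: measurable_funM; exact: measurableT_comp.
apply: ler_pM; [exact: Ex_ge0|exact: Ex_ge0| |]; apply: Ex_le => //; exact: L1_abs.
Qed.

(** Compare a and b, and replace the smaller one by the larger one. *)
Lemma cube_mul_le (a b : R) : 0 <= a -> 0 <= b -> a ^+ 3 * b <= a ^+ 4 + b ^+ 4.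
Proof.
move=> a0 b0; have [h|h] := leP b a.
  apply: (@le_trans _ _ (a ^+ 3 * a)); first by rewrite ler_wpM2l ?exprn_ge0.
  by rewrite -exprSr lerDl exprn_ge0.
apply: (@le_trans _ _ (b ^+ 3 * b)).
  by rewrite ler_wpM2r// lerXn2r ?nnegrE// ltW.
by rewrite -exprSr lerDr exprn_ge0.
Qed.

Lemma le_one_pow4 (a : R) k : 0 <= a -> (k <= 4)%N -> a ^+ k <= 1 + a ^+ 4.
Proof.
move=> a0 k4; have [h|h] := leP a 1.
  by apply: (@le_trans _ _ 1); rewrite ?exprn_ile1// lerDl exprn_ge0.
by apply: (@le_trans _ _ (a ^+ 4)); rewrite ?ler_weXn2l ?(ltW h)// lerDr.
Qed.

Lemma truncation_error (x A : R) : 1 <= A -> 0 <= x ->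
  0 <= x - Num.min x A <= x ^+ 3 / A ^+ 2.
Proof.
move=> A1 x0; have A0 : 0 < A by lra.
have [h|h] := leP x A; first by rewrite subrr lexx /= divr_ge0 ?exprn_ge0// ltW.
rewrite subr_ge0 (ltW h)/= ler_pdivlMr ?exprn_gt0//.
apply: (@le_trans _ _ (x * x ^+ 2)); last by rewrite -exprS.
apply: ler_pM => //; rewrite ?subr_ge0 ?exprn_ge0 ?(ltW h) ?(ltW A0)//; first by lra.
by rewrite lerXn2r ?nnegrE// ltW.
Qed.

(** The truncation error is at most X^3 / A^2, so fourth moments suffice for
an error of order A^-2 in the covariance. *)
Lemma cov_truncation A C X Y N1 N2 :
  1 <= A ->
  measurable_fun setT X -> measurable_fun setT Y ->
  (forall w, 0 <= X w <= N1 w) -> (forall w, 0 <= Y w <= N2 w) ->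
  L1 (fun w => N1 w ^+ 4) -> L1 (fun w => N2 w ^+ 4) ->
  Ex (fun w => N1 w ^+ 4) <= C -> Ex (fun w => N2 w ^+ 4) <= C ->
  `|cov (fun w => X w - Num.min (X w) A) Y| <= 2 * (1 + C) ^+ 2 / A ^+ 2.
Proof.
move=> A1 mX mY X0 Y0 L4 L4' E4 E4'.
have A0 : 0 < A ^+ 2 by rewrite exprn_gt0//; lra.
have C0 : 0 <= C by apply: le_trans E4; apply: Ex_ge0 => w; rewrite exprn_even_ge0.
have N10 w : 0 <= N1 w by have := X0 w; lra.
have N20 w : 0 <= N2 w by have := Y0 w; lra.
have LD1 : L1 (fun w => 1 + N1 w ^+ 4) by apply: L1D => //; exact: L1_cst.
have LD2 : L1 (fun w => 1 + N2 w ^+ 4) by apply: L1D => //; exact: L1_cst.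
have LD : L1 (fun w => N1 w ^+ 4 + N2 w ^+ 4) by exact: L1D.
have U3 w : `|X w - Num.min (X w) A| <= (A ^+ 2)^-1 * N1 w ^+ 3.
  have /andP[X0w XN] := X0 w; have /andP[h1 h2] := truncation_error A1 X0w.
  rewrite ger0_norm//; apply: le_trans h2 _; rewrite mulrC ler_wpM2l ?invr_ge0 ?(ltW A0)//.
  by rewrite lerXn2r ?nnegrE.
apply: (le_trans (cov_dom (Z := fun w => (A ^+ 2)^-1 * (N1 w ^+ 4 + N2 w ^+ 4))
   (ZU := fun w => (A ^+ 2)^-1 * (1 + N1 w ^+ 4)) (ZV := fun w => 1 + N2 w ^+ 4) _ _ _ _ _ _ _ _)) => //.
- by apply: measurable_funB => //; exact: measurable_minr.
- exact: L1Z.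
- exact: L1Z.
- move=> w; apply: (@le_trans _ _ ((A ^+ 2)^-1 * N1 w ^+ 3 * N2 w)).
    by apply: ler_pM => //; have /andP[? ?] := Y0 w; rewrite ger0_norm.
  by rewrite -mulrA ler_wpM2l ?invr_ge0 ?(ltW A0)// cube_mul_le.
- move=> w; apply: le_trans (U3 w) _.
  by rewrite ler_wpM2l ?invr_ge0 ?(ltW A0)// le_one_pow4.
- move=> w; have /andP[? YN] := Y0 w; rewrite ger0_norm//; apply: le_trans YN _.
  by rewrite -[leLHS]expr1 le_one_pow4.
rewrite !ExZ// !ExD//; [|exact: L1_cst..]; rewrite !Ex_cst.
set a := Ex _ in E4 *; set b := Ex _ in E4' *.
have a0 : 0 <= a by apply: Ex_ge0 => w; rewrite exprn_even_ge0.
have b0 : 0 <= b by apply: Ex_ge0 => w; rewrite exprn_even_ge0.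
rewrite -mulrA -mulrDr [leRHS]mulrC ler_wpM2l ?invr_ge0 ?(ltW A0)//.
have h1 : 0 <= (C - a) * (1 + b) by rewrite mulr_ge0//; lra.
have h2 : 0 <= (1 + C) * (C - b) by rewrite mulr_ge0//; lra.
have h3 : 0 <= C ^+ 2 by exact: sqr_ge0.
rewrite expr2 in h3 *; lra.
Qed.

Lemma cov_change_bounded A phi X X' Y B :
  0 <= A -> measurable_fun setT X -> measurable_fun setT X' -> measurable_fun setT Y ->
  (forall w, 0 <= X w <= A) -> (forall w, 0 <= X' w <= A) -> (forall w, 0 <= Y w <= A) ->
  measurable B -> (forall w, ~ B w -> X w = X' w) -> pr B <= phi ->
  `|cov (fun w => X w - X' w) Y| <= 2 * phi * A ^+ 2.
Proof.
move=> A0 mX mX' mY X0 X'0 Y0 mB XX' hB.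
have U1 w : `|X w - X' w| <= A * \1_B w.
  rewrite indicE; case: (boolP (w \in B)) => [_|].
    by have := X0 w; have := X'0 w; rewrite mulr1 ler_norml; lra.
  by rewrite notin_setE => /XX' ->; rewrite subrr normr0 mulr0.
have LI k : L1 (fun w => k * \1_B w) by apply: L1Z; exact: L1_indic.
have Y1 w : `|Y w| <= A by have /andP[? ?] := Y0 w; rewrite ger0_norm.
apply: (le_trans (cov_dom (Z := fun w => A ^+ 2 * \1_B w)
   (ZU := fun w => A * \1_B w) (ZV := fun=> A) _ _ _ _ _ _ _ _)) => //.
- exact: measurable_funB.
- exact: L1_cst.
- by move=> w; rewrite expr2 -mulrA [A * (\1_B w)]mulrC mulrA ler_pM//.
rewrite !ExZ ?Ex_indic ?Ex_cst//; [|exact: L1_indic..].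
have h : 0 <= (phi - pr B) * A ^+ 2 by rewrite mulr_ge0 ?sqr_ge0//; lra.
rewrite expr2 in h *; lra.
Qed.

(** Both variables are truncated at level A (error O(A^-2)), then replaced by
their local versions X', Y', which differ on an event of probability phi (error
O(A^2 phi)), and the mixing bound is applied to the results.  The first
error decreases and the others increase with A, which is therefore left free. *)
Lemma cov_mixing_local (F G : set (set T)) (al phi A C : R) X Y X' Y' N1 N2 BX BY :
  F `<=` measurable -> G `<=` measurable -> F set0 -> G set0 ->
  (forall B D, F B -> G D -> `|pr (B `&` D) - pr B * pr D| <= al) ->
  (forall c, F [set w | c <= X' w]) -> (forall c, G [set w | c <= Y' w]) ->
  1 <= A ->
  measurable_fun setT X -> measurable_fun setT Y ->
  measurable_fun setT X' -> measurable_fun setT Y' ->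
  (forall w, 0 <= X w <= N1 w) -> (forall w, 0 <= Y w <= N2 w) ->
  (forall w, 0 <= X' w) -> (forall w, 0 <= Y' w) ->
  L1 (fun w => N1 w ^+ 4) -> L1 (fun w => N2 w ^+ 4) ->
  Ex (fun w => N1 w ^+ 4) <= C -> Ex (fun w => N2 w ^+ 4) <= C ->
  measurable BX -> measurable BY ->
  (forall w, ~ BX w -> X w = X' w) -> (forall w, ~ BY w -> Y w = Y' w) ->
  pr BX <= phi -> pr BY <= phi ->
  `|cov X Y| <= 4 * (1 + C) ^+ 2 / A ^+ 2 + A ^+ 2 * (4 * phi + al).
Proof.
move=> Fm Gm F0 G0 mix FX GY A1 mX mY mX' mY' X0 Y0 X'0 Y'0 L4 L4' E4 E4'.
move=> mBX mBY BXE BYE pBX pBY.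
have A0 : 0 <= A by lra.
pose tr Z := (fun w => Num.min (Z w) A).
have mtr Z : measurable_fun setT Z -> measurable_fun setT (tr Z).
  by move=> mZ; apply: measurable_minr.
have tr0 Z : (forall w, 0 <= Z w) -> forall w, 0 <= tr Z w <= A.
  by move=> hZ w; rewrite /tr le_min hZ A0 ge_min lexx orbT.
have trle Z N : (forall w, 0 <= Z w <= N w) -> forall w, 0 <= tr Z w <= N w.
  move=> hZ w; have /andP[? ?] := hZ w; apply/andP; split.
    by rewrite /tr le_min A0 andbT.
  by rewrite /tr ge_min; apply/orP; left.
have X00 w : 0 <= X w by have := X0 w; lra.
have Y00 w : 0 <= Y w by have := Y0 w; lra.
have LX Z N : measurable_fun setT Z -> (forall w, 0 <= Z w <= N w) -> L1 (fun w => N w ^+ 4) -> L1 Z.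
  move=> mZ hZ LN; apply: (L1_le (Z := fun w => 1 + N w ^+ 4)) => //.
    move=> w; have /andP[h1 h2] := hZ w; rewrite ger0_norm// (le_trans h2)//.
    by rewrite -[leLHS]expr1 le_one_pow4// (le_trans h1).
  by apply: L1D => //; exact: L1_cst.
have LXY Z W : measurable_fun setT Z -> measurable_fun setT W ->
    (forall w, 0 <= Z w <= N1 w) -> (forall w, 0 <= W w <= N2 w) -> L1 (fun w => Z w * W w).
  move=> mZ mW hZ hW; apply: (L1_le (Z := fun w => (1 + N1 w ^+ 4) + (1 + N2 w ^+ 4))).
  - exact: measurable_funM.
  - move=> w; have /andP[z0 zN] := hZ w; have /andP[w0 wN] := hW w.
    rewrite ger0_norm ?mulr_ge0//.
    apply: (@le_trans _ _ (N1 w * N2 w)); first by apply: ler_pM.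
    have h1 := le_one_pow4 (le_trans z0 zN) (isT : 2 <= 4)%N.
    have h2 := le_one_pow4 (le_trans w0 wN) (isT : 2 <= 4)%N.
    have := sqr_ge0 (N1 w - N2 w).
    have := sqr_ge0 (N1 w + N2 w); rewrite !expr2 in h1 h2 *; lra.
  - by apply: L1D; apply: L1D => //; exact: L1_cst.
have bnd Z W : measurable_fun setT Z -> measurable_fun setT W ->
    (forall w, 0 <= Z w) -> (forall w, 0 <= W w) -> L1 (fun w => tr Z w * tr W w).
  move=> mZ mW Z0 W0; apply: (@L1_bounded _ _ _ _ (A * A)).
    by apply: measurable_funM; exact: mtr.
  move=> w; have /andP[? ?] := tr0 _ Z0 w; have /andP[? ?] := tr0 _ W0 w.
  by rewrite normrM !ger0_norm// ler_pM.
have bnd1 Z : measurable_fun setT Z -> (forall w, 0 <= Z w) -> L1 (tr Z).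
  move=> mZ Z0; apply: (@L1_bounded _ _ _ _ A); first exact: mtr.
  by move=> w; have /andP[? ?] := tr0 _ Z0 w; rewrite ger0_norm.
rewrite (cov_perturb (X' := tr X) (Y' := tr Y)); last 7 first.
- exact: LX X0 L4.
- exact: LX Y0 L4'.
- exact: bnd1.
- exact: bnd1.
- exact: LXY.
- by apply: LXY => //; [exact: mtr|exact: trle].
- exact: bnd.
rewrite (cov_perturb (X := tr X) (X' := tr X') (Y' := tr Y')); 
  [|exact: bnd1..|exact: bnd|exact: bnd|exact: bnd].
have t1 : `|cov (fun w => X w - tr X w) Y| <= 2 * (1 + C) ^+ 2 / A ^+ 2.
  exact: (@cov_truncation A C X Y N1 N2).
have t2 : `|cov (tr X) (fun w => Y w - tr Y w)| <= 2 * (1 + C) ^+ 2 / A ^+ 2.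
  rewrite covC; apply: (@cov_truncation A C Y (tr X) N2 N1) => //; [exact: mtr|exact: trle].
have t3 : `|cov (fun w => tr X w - tr X' w) (tr Y)| <= 2 * phi * A ^+ 2.
  apply: (@cov_change_bounded A phi (tr X) (tr X') (tr Y) BX) => //;
    [exact: mtr..|exact: tr0|exact: tr0|exact: tr0|].
  by move=> w /BXE; rewrite /tr => ->.
have t4 : `|cov (tr X') (fun w => tr Y w - tr Y' w)| <= 2 * phi * A ^+ 2.
  rewrite covC; apply: (@cov_change_bounded A phi (tr Y) (tr Y') (tr X') BY) => //;
    [exact: mtr..|exact: tr0|exact: tr0|exact: tr0|].
  by move=> w /BYE; rewrite /tr => ->.
have lev (H : set (set T)) Z c : H set0 -> (forall c, H [set w | c <= Z w]) ->
    H [set w | c <= tr Z w].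
  move=> H0 HZ; have [h|h] := leP c A.
    rewrite (_ : [set w | _] = [set w | c <= Z w])//.
    by apply/seteqP; split => w /=; rewrite /tr le_min h andbT.
  rewrite (_ : [set w | _] = set0)//.
  by apply/seteqP; split => w //=; rewrite /tr le_min (leNgt c A) h andbF.
have t5 : `|cov (tr X') (tr Y')| <= A ^+ 2 * al.
  apply: (cov_bounded_mixing Fm Gm mix);
    [by move=> c; exact: lev|by move=> c; exact: lev|exact: mtr|exact: mtr
    |exact: tr0|exact: tr0].
have -> : 4 * (1 + C) ^+ 2 / A ^+ 2 = 2 * (1 + C) ^+ 2 / A ^+ 2 + 2 * (1 + C) ^+ 2 / A ^+ 2.
  by rewrite -mulrDl; congr (_ / _); ring.
move: t1 t2 t3 t4 t5; rewrite !ler_norml; lra.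
Qed.

End local_mixing.

(** * Observation counts and the sigma-algebras they generate *)

Section sampling.
Context {d : measure_display} {T : measurableType d} {R : realType}.
Variable P : probability T R.
Variables (h : nat -> R) (M : nat -> 'I_2 -> T -> nat).
Variable S : nat -> 'I_2 -> nat -> T -> R.
Hypothesis h_gt0 : forall n, (0 < n)%N -> 0 < h n.
Hypothesis MS : sampling_times h M S.
Notation L1 := (L1 P). Notation Ex := (Ex P). Notation pr := (pr P).
Notation cov := (cov P).
Implicit Types (n u i j : nat) (l : 'I_2) (t x y : R).

Definition points n l w : seq R := path_points (M n l w) (S n l ^~ w).

Definition count_in n l (x y : R) w : nat := count (fun z => x < z <= y) (points n l w).

Lemma points_sorted n l w : (0 < n)%N -> sorted <%R (points n l w).
Proof. by move=> n0; have [_ _ /(_ w)[_ _ h3 _]] := MS l n0; apply: path_points_sorted. Qed.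

Lemma points_head n l w : (0 < n)%N -> head 0 (points n l w) = 0.
Proof. by move=> n0; have [_ _ /(_ w)[_ h2 _ _]] := MS l n0. Qed.

Lemma points_ge0 n l w : (0 < n)%N -> all (>=%R^~ 0) (points n l w).
Proof.
move=> n0; have := points_sorted l w n0; have := points_head l w n0.
rewrite /points /path_points /= => -> ss; rewrite lexx /=.
by apply: sub_all (order_path_min lt_trans ss) => z /ltW.
Qed.

Lemma behead_points_gt0 n l w : (0 < n)%N -> all (>%R^~ 0) (behead (points n l w)).
Proof.
move=> n0; have := points_sorted l w n0; have := points_head l w n0.
rewrite /points /path_points /= => -> ss.
exact: (order_path_min lt_trans ss).
Qed.

Lemma points_le n l w : (0 < n)%N -> all (<=%R^~ (n%:R * h n)) (points n l w).
Proof.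
move=> n0; have [_ _ /(_ w)[_ _ h3 <-]] := MS l n0.
apply/allP => z /mapP[i]; rewrite mem_iota /= add0n ltnS => iM ->.
elim: (M n l w) iM h3 => [|m IHm]; first by rewrite leqn0 => /eqP -> _.
rewrite leq_eqVlt => /orP[/eqP -> //|]; rewrite ltnS => im h3.
apply: le_trans (ltW (h3 m _)) => //.
by apply: IHm => // k km; apply: h3; rewrite ltnS ltnW.
Qed.

Lemma incr_count n l t1 t2 w : (0 < n)%N -> 0 <= t1 -> t1 <= t2 ->
  incr M S n l t1 t2 w = (count_in n l t1 t2 w)%:R.
Proof.
move=> n0 t10 t12; have [_ _ /(_ w)[_ h2 h3 _]] := MS l n0.
by rewrite /incr count_upto_incr.
Qed.

(** Windows starting at -1 also contain the origin, which the counting process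
does not count although it is an endpoint of the first interval. *)
Lemma count_in_neg n l y w : (0 < n)%N ->
  count_in n l (-1) y w = if 0 <= y then (count_in n l 0 y w).+1 else 0%N.
Proof.
move=> n0; have := points_head l w n0; have /allP := behead_points_gt0 l w n0.
rewrite /count_in /points /path_points /= => h1 ->; rewrite ltxx /= add0n.
rewrite (_ : -1 < 0 :> R) /=; last by lra.
have [y0|y0] := leP 0 y.
  rewrite add1n; congr _.+1; apply: eq_in_count => z /h1 z0.
  by rewrite z0 (_ : -1 < z)//; lra.
rewrite add0n; apply/eqP; rewrite -(negbK (_ == _)) -lt0n -has_count.
by apply/hasPn => z /h1 z0; rewrite negb_and -!ltNge (lt_trans y0 z0) orbT.
Qed.

Lemma measurable_count_upto n l t : (0 < n)%N ->
  measurable_fun setT (fun w => (count_upto (M n l w) (S n l ^~ w) t)%:R : R).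
Proof.
move=> n0; have [mM mS _] := MS l n0.
pose E i := [set w | (i <= M n l w)%N] `&` [set w | S n l i w <= t].
have mE i : measurable (E i).
  rewrite /E (_ : [set w | S n l i w <= t] = S n l i @^-1` `]-oo, t]); last first.
    by apply/seteqP; split => w /=; rewrite in_itv.
  apply: mS => //; rewrite -[X in measurable X]setTI.
  exact: (mM _ [set k | (i <= k)%N]).
apply: (measurable_fun_glue (g := fun k w => \sum_(i <- iota 1 k) \1_(E i) w) mM).
  by move=> k; apply: measurable_sum => i; exact: measurable_indic.
move=> w; rewrite /count_upto natr_sum /index_iota subSS subn0.
apply: eq_big_seq => i; rewrite mem_iota add1n ltnS => /andP[_ iM].
rewrite indicE /E; congr (_ %:R); congr nat_of_bool.
by apply/idP/idP; rewrite inE /= => // -[].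
Qed.

Lemma measurable_incr n l t1 t2 : (0 < n)%N -> measurable_fun setT (incr M S n l t1 t2).
Proof. by move=> n0; apply: measurable_funB; exact: measurable_count_upto. Qed.

Lemma measurable_count_in n l t1 t2 : (0 < n)%N -> 0 <= t1 -> t1 <= t2 ->
  measurable_fun setT (count_in n l t1 t2).
Proof.
move=> n0 t10 t12; apply: (@measurable_fun_natr R).
by under eq_fun do rewrite -incr_count//; exact: measurable_incr.
Qed.

Definition incr_gen n i j : set (set T) :=
  [set A | exists (l : 'I_2) (t1 t2 : R) (B : set R),
       [/\ i%:R * h n <= t1, t1 < t2, t2 <= j%:R * h n, measurable B &
           A = incr M S n l t1 t2 @^-1` B]].

Lemma incr_sigma_sub n i j : (0 < n)%N -> incr_sigma h M S n i j `<=` measurable.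
Proof.
move=> n0; apply: smallest_sub; first exact: sigma_algebra_measurable.
move=> A [l [t1 [t2 [B [_ _ _ mB ->]]]]].
by rewrite -[X in measurable X]setTI; exact: measurable_incr.
Qed.

Lemma incr_sigma0 n i j : incr_sigma h M S n i j set0.
Proof. exact: sigma_algebra0. Qed.

Lemma incr_sigma_count n l i j t1 t2 : (0 < n)%N ->
  i%:R * h n <= t1 -> t1 <= t2 -> t2 <= j%:R * h n ->
  measurable_fun (T := g_sigma_algebraType (incr_gen n i j)) setT (count_in n l t1 t2).
Proof.
move=> n0 it1 t12 t2j; apply: (@measurable_fun_natr R).
have t10 : 0 <= t1 by apply: le_trans it1; rewrite mulr_ge0// ltW// h_gt0.
have [->|ne] := eqVneq t1 t2.
  rewrite (_ : (fun w => _) = cst 0)//; apply/funext => w /=.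
  rewrite /count_in (eq_count (a2 := pred0)) ?count_pred0// => z /=.
  by apply/negbTE; rewrite negb_and -leNgt -ltNge; case: leP.
rewrite (_ : (fun w => _) = incr M S n l t1 t2); last first.
  by apply/funext => w; rewrite incr_count.
move=> _ B mB; rewrite setTI; apply: sub_sigma_algebra.
by exists l, t1, t2, B; split=> //; rewrite lt_neqAle ne.
Qed.

Lemma incr_sigma_count_neg n l j t : (0 < n)%N -> t <= j%:R * h n ->
  measurable_fun (T := g_sigma_algebraType (incr_gen n 0 j)) setT (count_in n l (-1) t).
Proof.
move=> n0 tj.
rewrite (_ : count_in n l (-1) t = fun w => if 0 <= t then (count_in n l 0 t w).+1 else 0%N); last first.
  by apply/funext => w; rewrite count_in_neg.
have [t0|t0] := leP 0 t; last exact: measurable_cst.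
rewrite (_ : (fun w => _) = succn \o count_in n l 0 t)//.
by apply: measurableT_comp => //; apply: incr_sigma_count => //; rewrite mul0r.
Qed.

Definition trace_in n l1 l2 p (x y : R) w : R :=
  loop_sum (fun z => x < z <= y) (intervals (points n l1 w)) (intervals (points n l2 w)) p.

(** As trace_in, but seeing only the observations of the window (a, b]. *)
Definition local_trace n l1 l2 p (a b x y : R) w : R :=
  loop_sum (fun z => x < z <= y) (intervals (window a b (points n l1 w)))
    (intervals (window a b (points n l2 w))) p.

(** The window starts at -1, so as to contain the origin: the past of the
time i h_n includes the first observation interval. *)
Lemma local_trace_sigma_left n l1 l2 p i x y c : (0 < n)%N ->
  incr_sigma h M S n 0 i [set w | c <= local_trace n l1 l2 p (-1) (i%:R * h n) x y w].
Proof.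
move=> n0.
have ih0 : 0 <= i%:R * h n by rewrite mulr_ge0// ltW// h_gt0.
have : measurable_fun (T := g_sigma_algebraType (incr_gen n 0 i)) setT
    (local_trace n l1 l2 p (-1) (i%:R * h n) x y).
  apply: measurable_loop_sum => //.
  - by lra.
  - by move=> w; exact: points_sorted.
  - by move=> w; exact: points_sorted.
  - by move=> t /andP[_ t1]; exact: incr_sigma_count_neg.
  - by move=> t /andP[_ t1]; exact: incr_sigma_count_neg.
move=> /(_ measurableT `[c, +oo[%classic (measurable_itv _)); rewrite setTI.
by congr (measurable _); apply/seteqP; split => w /=; rewrite in_itv/= andbT.
Qed.

Lemma local_trace_sigma_right n l1 l2 p i x y c : (i <= n)%N -> (0 < n)%N ->
  incr_sigma h M S n i n
    [set w | c <= local_trace n l1 l2 p (i%:R * h n) (n%:R * h n) x y w].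
Proof.
move=> in_ n0.
have : measurable_fun (T := g_sigma_algebraType (incr_gen n i n)) setT
    (local_trace n l1 l2 p (i%:R * h n) (n%:R * h n) x y).
  apply: measurable_loop_sum => //.
  - by rewrite ler_wpM2r ?ler_nat// ltW// h_gt0.
  - by move=> w; exact: points_sorted.
  - by move=> w; exact: points_sorted.
  - by move=> t /andP[t0 t1]; exact: incr_sigma_count.
  - by move=> t /andP[t0 t1]; exact: incr_sigma_count.
move=> /(_ measurableT `[c, +oo[%classic (measurable_itv _)); rewrite setTI.
by congr (measurable _); apply/seteqP; split => w /=; rewrite in_itv/= andbT.
Qed.

Lemma window_full n l w : (0 < n)%N -> window (-1) (n%:R * h n) (points n l w) = points n l w.
Proof.
move=> n0; apply/all_filterP; apply/allP => z zs.
have /allP/(_ _ zs) z0 := points_ge0 l w n0; have /allP/(_ _ zs) /= -> := points_le l w n0.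
by rewrite andbT (lt_le_trans _ z0)//; lra.
Qed.

Lemma local_trace_full n l1 l2 p x y w : (0 < n)%N ->
  local_trace n l1 l2 p (-1) (n%:R * h n) x y w = trace_in n l1 l2 p x y w.
Proof. by move=> n0; rewrite /local_trace !window_full. Qed.

Lemma measurable_fun_of_ge (f : T -> R) : (forall c, measurable [set w | c <= f w]) ->
  measurable_fun setT f.
Proof.
move=> mf; rewrite (_ : f = \- (\- f)); last by apply/funext => w; rewrite /= opprK.
apply: measurable_funN; apply: measurable_fun_of_le => t.
rewrite (_ : [set w | _] = [set w | - t <= f w])//.
by apply/seteqP; split => w /=; rewrite lerNl.
Qed.

Lemma measurable_local_trace_left n l1 l2 p i x y : (0 < n)%N ->
  measurable_fun setT (local_trace n l1 l2 p (-1) (i%:R * h n) x y).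
Proof.
move=> n0; apply: measurable_fun_of_ge => c.
by apply: (@incr_sigma_sub n 0 i n0); exact: local_trace_sigma_left.
Qed.

Lemma measurable_local_trace_right n l1 l2 p i x y : (i <= n)%N -> (0 < n)%N ->
  measurable_fun setT (local_trace n l1 l2 p (i%:R * h n) (n%:R * h n) x y).
Proof.
move=> in_ n0; apply: measurable_fun_of_ge => c.
by apply: (@incr_sigma_sub n i n n0); exact: local_trace_sigma_right.
Qed.

Lemma measurable_trace_in n l1 l2 p x y : (0 < n)%N ->
  measurable_fun setT (trace_in n l1 l2 p x y).
Proof.
move=> n0; rewrite (_ : trace_in n l1 l2 p x y =
  local_trace n l1 l2 p (-1) (n%:R * h n) x y); first exact: measurable_local_trace_left.
by apply/funext => w; rewrite local_trace_full.
Qed.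

Lemma trace_in_bounds n l1 l2 p x y w : (0 < n)%N ->
  0 <= trace_in n l1 l2 p x y w <= (count_in n l1 x y w)%:R.
Proof.
move=> n0; rewrite loop_sum_ge0/=.
apply: le_trans (loop_sum_le _ _ _ _) _; [exact: points_sorted..|].
by rewrite ler_nat /count_in; case: (points n l1 w) => //= z s; exact: leq_addl.
Qed.

End sampling.

(** * Real-valued form of the assumptions *)

Section constants.
Context {d : measure_display} {T : measurableType d} {R : realType}.
Variable P : probability T R.
Variables (h : nat -> R) (M : nat -> 'I_2 -> T -> nat).
Variable S : nat -> 'I_2 -> nat -> T -> R.
Hypothesis h_gt0 : forall n, (0 < n)%N -> 0 < h n.
Hypothesis MS : sampling_times h M S.
Notation L1 := (L1 P). Notation Ex := (Ex P). Notation pr := (pr P).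
Notation cov := (cov P).
Notation count_in := (count_in M S).

Lemma lty_bound (x : \bar R) : (x < +oo)%E -> exists2 C : R, 0 <= C & (x <= C%:E)%E.
Proof.
case: x => [r _|//|_]; last by exists 0; rewrite ?leNye.
by exists `|r|; rewrite ?lee_fin ?ler_norm.
Qed.

(** Turns a bound on an expectation in the extended reals into integrability and
a bound on the real-valued integral. *)
Lemma L1_of_expectation (X : T -> R) : measurable_fun setT X -> (forall w, 0 <= X w) ->
  forall C : R, ('E_P[X] <= C%:E)%E -> L1 X /\ Ex X <= C.
Proof.
move=> mX X0 C; rewrite unlock => XC.
have LX : L1 X.
  apply/integrableP; split; first exact/measurable_EFinP.
  apply: le_lt_trans (ltry C); apply: le_trans XC.
  apply: ge0_le_integral => //.
  - exact/measurableT_comp/measurable_EFinP.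
  - exact/measurable_EFinP.
  - by move=> w _ /=; rewrite ger0_norm.
split=> //; rewrite -lee_fin /Ex /Rintegral fineK//.
exact: integrable_fin_num LX.
Qed.

(** The real-valued content of [B1] for q = 4, at the times t = j h_n only. *)
Lemma B1_moment : B1 P h M S 4%:R -> exists2 C : R, 0 <= C &
  forall n l j, (0 < n)%N -> (j < n)%N ->
  L1 (fun w => (count_in n l (j%:R * h n) (j.+1%:R * h n) w)%:R ^+ 4) /\
  Ex (fun w => (count_in n l (j%:R * h n) (j.+1%:R * h n) w)%:R ^+ 4) <= C.
Proof.
move=> /lty_bound[C C0 hC]; exists C => // n l j n0 jn.
have h0 := h_gt0 n0.
have j0 : 0 <= j%:R * h n by rewrite mulr_ge0// ltW.
have jE : j.+1%:R * h n = j%:R * h n + h n by rewrite -natr1 mulrDl mul1r.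
have jj : j%:R * h n <= j.+1%:R * h n by rewrite jE lerDl ltW.
apply: L1_of_expectation.
- apply: measurable_funX.
  rewrite (_ : (fun w => _) = incr M S n l (j%:R * h n) (j.+1%:R * h n)).
    exact: (measurable_incr MS).
  by apply/funext => w; rewrite (incr_count MS).
- by move=> w; rewrite exprn_ge0.
apply: le_trans hC; apply: le_trans (ereal_sup_ubound _); last by exists n.
apply: le_trans (le_bigmax _ _ l); apply: ereal_sup_ubound => /=.
exists (j%:R * h n).
  rewrite j0 /= ler_wpM2r ?(ltW h0)// lerBrDr natr1 ler_nat//.
congr expectation; apply/funext => w.
by rewrite -jE (incr_count MS)// powR_mulrn.
Qed.

(** Real-valued content of [B2] for q = 4.  The limit superior only concerns large
u; for the others the constant makes the bound at least 1. *)
Lemma B2_void : B2 P h M S 4%:R -> exists2 C : R, 0 <= C &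
  forall n l u t, (0 < n)%N -> 0 <= t -> t + u%:R * h n <= n%:R * h n ->
  pr [set w | count_in n l t (t + u%:R * h n) w = 0%N] <= C / u.+1%:R ^+ 4.
Proof.
move=> /ereal_inf_lt[_ [V [v [_ hv]] <-]] /lty_bound[C C0 hC].
(* 16 comes from u + 1 <= 2 u; the other term serves for u <= |v| + 1 *)
exists (16 * C + (`|v| + 2) ^+ 4).
  by rewrite addr_ge0 ?mulr_ge0// exprn_ge0// addr_ge0.
move=> n l u t n0 t0 tu.
have uh0 : 0 <= u%:R * h n by rewrite mulr_ge0// ltW// h_gt0.
have mA : measurable [set w | count_in n l t (t + u%:R * h n) w = 0%N].
  rewrite -[X in measurable X]setTI.
  have tt : t <= t + u%:R * h n by rewrite lerDl.
  have mc := measurable_count_in MS l n0 t0 tt.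
  by rewrite [X in measurable X](_ : _ = setT `&` (count_in n l t (t + u%:R * h n)) @^-1` [set 0%N])//; exact: mc.
have u10 : 0 < u.+1%:R ^+ 4 :> R by rewrite exprn_gt0// ltr0n.
rewrite ler_pdivlMr//.
have p1 := pr_le1 P mA; have p0 := pr_ge0 P [set w | count_in n l t (t + u%:R * h n) w = 0%N].
set q := pr _ in p1 p0 *.
have v0 := normr_ge0 v.
have [uv|vu] := leP (u%:R : R) (`|v| + 1).
  apply: (@le_trans _ _ (1 * (`|v| + 2) ^+ 4)).
    apply: ler_pM => //.
    by rewrite lerXn2r ?nnegrE ?ler0n ?addr_ge0// -natr1; lra.
  by rewrite mul1r lerDr mulr_ge0.
have uv : V u%:R by apply: hv; have := ler_norm v; lra.
have : u%:R ^+ 4 * q <= C.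
  rewrite -lee_fin EFinM -(prE P mA); apply: le_trans hC.
  apply: le_trans (ereal_sup_ubound _); last by exists u%:R.
  apply: le_trans (ereal_sup_ubound _); last by exists n.
  apply: le_trans (le_bigmax _ _ l); apply: ereal_sup_ubound => /=.
  exists t; first by rewrite t0 lerBrDr.
  rewrite powR_mulrn//; congr (_ * P _)%E.
  apply/seteqP; split => w /=; rewrite (incr_count MS)// ?lerDl//.
    by move=> /eqP; rewrite (eqr_nat R _ 0) => /eqP.
  by move=> ->.
have : u.+1%:R ^+ 4 <= 16 * u%:R ^+ 4 :> R.
  have -> : 16 * u%:R ^+ 4 = (2 * u%:R) ^+ 4 :> R by rewrite exprMn; congr (_ * _); ring.
  rewrite lerXn2r ?nnegrE ?mulr_ge0//.
  by rewrite -natr1; lra.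
have : 0 <= (`|v| + 2) ^+ 4 by rewrite exprn_ge0//; lra.
move: (u%:R ^+ 4) (u.+1%:R ^+ 4) (_ ^+ 4) => a b c c0 ba aC.
have : 0 <= (16 * a - b) * q by rewrite mulr_ge0//; lra.
lra.
Qed.

(** Each term of a series of nonnegative terms is at most its sum, here with
exponent 4. *)
Lemma mixing_rate : mixing_summable P h M S 4%:R -> exists2 C : R, 0 <= C &
  forall n u i j A B, (0 < i)%N -> (j < n)%N -> (i + u <= j)%N ->
  incr_sigma h M S n 0 i A -> incr_sigma h M S n j n B ->
  `|pr (A `&` B) - pr A * pr B| <= C / u.+1%:R ^+ 4.
Proof.
move=> /lty_bound[C C0 hC]; exists C => // n u i j A B i0 jn iuj FA GB.
have n0 : (0 < n)%N by lia.
have mA := incr_sigma_sub MS n0 FA; have mB := incr_sigma_sub MS n0 GB.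
have u10 : 0 < u.+1%:R ^+ 4 :> R by rewrite exprn_gt0// ltr0n.
have al0 k : (0 <= alpha P h M S n k)%E by rewrite /alpha le_max lexx.
have h1 : ((u.+1%:R ^+ 4)%:E * alpha P h M S n u <= C%:E)%E.
  apply: le_trans hC; apply: le_trans (ereal_sup_ubound _); last by exists n.
  apply: le_trans (nneseries_lim_ge u.+1 _); last first.
    by move=> k _ _; rewrite mule_ge0// lee_fin powR_ge0.
  rewrite big_nat_recr//= powR_mulrn// leeDr// sume_ge0// => k _.
  by rewrite mule_ge0// lee_fin powR_ge0.
rewrite ler_pdivlMr// mulrC -lee_fin EFinM; apply: le_trans h1.
apply: lee_wpmul2l; first by rewrite lee_fin ltW.
rewrite /alpha le_max; apply/orP; right.
apply: le_trans (ereal_sup_ubound _); last first.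
  exists (i, j) => //=; split; lia.
apply: le_trans (ereal_sup_ubound _); last by exists A.
apply: ereal_sup_ubound; exists B => //=.
have mAB : measurable (A `&` B) by exact: measurableI.
by rewrite (prE P mA) (prE P mB) (prE P mAB).
Qed.

Lemma pr_union (I : eqType) (r : seq I) (D : I -> set T) (A : set T) :
  (forall i, measurable (D i)) -> measurable A ->
  (forall w, A w -> exists2 i, i \in r & D i w) ->
  pr A <= \sum_(i <- r) pr (D i).
Proof.
move=> mD mA AD; rewrite -Ex_indic//.
rewrite (_ : \sum_(i <- r) pr (D i) = Ex (fun w => \sum_(i <- r) \1_(D i) w)); last first.
  rewrite Ex_sum; first by apply: eq_bigr => i _; rewrite Ex_indic.
  by move=> i; exact: L1_indic.
apply: Ex_le; first exact: L1_indic.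
  by apply: L1_sum => i; exact: L1_indic.
move=> w; rewrite indicE; have [|_] := boolP (w \in A); last by apply: sumr_ge0.
rewrite inE => /AD[i ir Dw]; rewrite (big_rem i)//= indicE mem_set//.
by rewrite lerDl sumr_ge0.
Qed.

Lemma pr_union_le (I : eqType) (r : seq I) (D : I -> set T) (A : set T) (phi : R) :
  (forall i, measurable (D i)) -> measurable A ->
  (forall w, A w -> exists2 i, i \in r & D i w) ->
  (forall i, i \in r -> pr (D i) <= phi) ->
  pr A <= (size r)%:R * phi.
Proof.
move=> mD mA AD hphi; apply: le_trans (pr_union mD mA AD) _.
rewrite mulr_natl -sum1_size -sumrMnr big_seq [leRHS]big_seq.
by apply: ler_sum => i ir; rewrite mulr1n hphi.
Qed.

End constants.

(** * Covariance of two cells *)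

Section cells.
Context {d : measure_display} {T : measurableType d} {R : realType}.
Variable P : probability T R.
Variables (h : nat -> R) (M : nat -> 'I_2 -> T -> nat).
Variable S : nat -> 'I_2 -> nat -> T -> R.
Hypothesis h_gt0 : forall n, (0 < n)%N -> 0 < h n.
Hypothesis MS : sampling_times h M S.
Notation L1 := (L1 P). Notation Ex := (Ex P). Notation pr := (pr P).
Notation cov := (cov P).
Notation count_in := (count_in M S).

Variables (C1 C2 C3 : R).
Hypotheses (C1_ge0 : 0 <= C1) (C2_ge0 : 0 <= C2) (C3_ge0 : 0 <= C3).
Hypothesis moment : forall n l j, (0 < n)%N -> (j < n)%N ->
  L1 (fun w => (count_in n l (j%:R * h n) (j.+1%:R * h n) w)%:R ^+ 4) /\
  Ex (fun w => (count_in n l (j%:R * h n) (j.+1%:R * h n) w)%:R ^+ 4) <= C1.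
Hypothesis void : forall n l u t, (0 < n)%N -> 0 <= t -> t + u%:R * h n <= n%:R * h n ->
  pr [set w | count_in n l t (t + u%:R * h n) w = 0%N] <= C2 / u.+1%:R ^+ 4.
Hypothesis mixing : forall n u i j A B, (0 < i)%N -> (j < n)%N -> (i + u <= j)%N ->
  incr_sigma h M S n 0 i A -> incr_sigma h M S n j n B ->
  `|pr (A `&` B) - pr A * pr B| <= C3 / u.+1%:R ^+ 4.

Variables (l1 l2 : 'I_2) (p : nat).

(** Contribution of the part of the block (x, y] in the cell number j.  The
observations at the edges of the block thus need no separate treatment. *)
Definition cell_trace n (x y : R) j : T -> R :=
  trace_in M S n l1 l2 p (Num.max x (j%:R * h n)) (Num.min y (j.+1%:R * h n)).

Definition void_set n u (e : R) (l : 'I_2) : set T :=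
  [set w | count_in n l e (e + u%:R * h n) w = 0%N].

(** Outside of this event, each of the k stretches of u cells starting at the e s
contains observations of both processes. *)
Definition void_union n u (e : nat -> R) k : set T :=
  \bigcup_(sl in [set` [seq (s, l) | s <- iota 0 k, l <- [:: l1; l2]]])
    void_set n u (e sl.1) sl.2.

Lemma measurable_void_set n u e l : (0 < n)%N -> 0 <= e -> measurable (void_set n u e l).
Proof.
move=> n0 e0; have ee : e <= e + u%:R * h n by rewrite lerDl mulr_ge0// ltW// h_gt0.
have mc := measurable_count_in MS l n0 e0 ee.
by rewrite -[void_set _ _ _ _]setTI; exact: (mc measurableT [set 0%N]).
Qed.

Lemma measurable_void_union n u e k : (0 < n)%N -> (forall s, 0 <= e s) ->
  measurable (void_union n u e k).
Proof.
move=> n0 e0; apply: fin_bigcup_measurable; first exact: finite_seq.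
by move=> sl _; exact: measurable_void_set.
Qed.

Lemma void_union_le n u e k : (0 < n)%N -> (forall s, 0 <= e s) ->
  (forall s, (s < k)%N -> e s + u%:R * h n <= n%:R * h n) ->
  pr (void_union n u e k) <= (k * 2)%:R * (C2 / u.+1%:R ^+ 4).
Proof.
move=> n0 e0 ek.
rewrite (_ : (k * 2)%N = size [seq (s, l) | s <- iota 0 k, l <- [:: l1; l2]]); last first.
  by rewrite size_allpairs size_iota.
apply: (pr_union_le (D := fun sl => void_set n u (e sl.1) sl.2)).
- by move=> sl; exact: measurable_void_set.
- exact: measurable_void_union.
- by move=> w [sl slr Dw]; exists sl.
- move=> [s l] /allpairsP[[s' l'] [/= + _ [-> _]]]; rewrite mem_iota /= add0n => sk.
  by apply: void => //; exact: ek.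
Qed.

Lemma not_void_union n u e k w s l : ~ void_union n u e k w -> (s < k)%N ->
  (l == l1) || (l == l2) ->
  has (fun x => e s < x <= e s + u%:R * h n) (points M S n l w).
Proof.
move=> nv sk ll; rewrite has_count lt0n; apply/eqP => c0; apply: nv.
suff slr : (s, l) \in [seq (s, l) | s <- iota 0 k, l <- [:: l1; l2]] by exists (s, l).
by apply/allpairsP; exists (s, l); split => //=; rewrite ?mem_iota// !inE.
Qed.

Lemma cell_trace_bounds n x y j w : (0 < n)%N ->
  0 <= cell_trace n x y j w <= (count_in n l1 (j%:R * h n) (j.+1%:R * h n) w)%:R.
Proof.
move=> n0; have /andP[-> h2] := trace_in_bounds MS l1 l2 p
  (Num.max x (j%:R * h n)) (Num.min y (j.+1%:R * h n)) w n0.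
apply: le_trans h2 _; rewrite ler_nat; apply: sub_count => z /=.
by rewrite gt_max le_min => /andP[/andP[_ ->] /andP[_ ->]].
Qed.

Lemma measurable_cell_trace n x y j : (0 < n)%N -> measurable_fun setT (cell_trace n x y j).
Proof. by move=> n0; apply: (measurable_trace_in h_gt0 MS). Qed.

Definition Kcov : R :=
  (4 * (1 + C1) ^+ 2 + 8 * p.*2.+1%:R * C2 + C3) * p.*2.*2.+2%:R ^+ 2.

Lemma Kcov_ge0 : 0 <= Kcov.
Proof.
rewrite /Kcov; apply: mulr_ge0 (sqr_ge0 _); apply: addr_ge0 => //; apply: addr_ge0.
  by apply: mulr_ge0 (sqr_ge0 _).
by apply: mulr_ge0 => //; apply: mulr_ge0.
Qed.

(** The gap between the cells is divided into 4 p + 2 parts of u cells each.  The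
window of the left cell takes 2 p of them, that of the right cell 2 p + 1, and
one remains to separate the windows. *)
Lemma cell_cov n x y j k : (0 < n)%N -> (j < k)%N -> (k < n)%N ->
  `|cov (cell_trace n x y j) (cell_trace n x y k)| <= Kcov / (k - j)%:R ^+ 2.
Proof.
move=> n0 jk kn; set q := p.*2; set D := q.*2.+2.
pose u := ((k - j).-1 %/ D)%N.
have uD : (u * D <= (k - j).-1)%N by exact: leq_trunc_div.
have hu : (k - j <= u.+1 * D)%N.
  have : ((k - j).-1 < u.+1 * D)%N by rewrite ltn_ceil.
  lia.
have h0 := h_gt0 n0.
have uh0 : 0 <= u%:R * h n by rewrite mulr_ge0// ltW.
pose eL s : R := (j.+1 + s * u)%:R * h n.
pose eR s : R := (k - s * u)%:R * h n.
have eL0 s : 0 <= eL s by rewrite mulr_ge0// ltW.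
have eR0 s : 0 <= eR s by rewrite mulr_ge0// ltW.
have eLS s : eL s.+1 = eL s + u%:R * h n.
  by rewrite /eL mulSn addnCA natrD mulrDl addrC.
(* q stretches for the left window, q.+1 for the right one, one as a gap *)
have Dq : D = (q + q.+1 + 1)%N by rewrite /D -addnn; lia.
have qu : (u * D = q * u + q.+1 * u + u)%N by rewrite Dq; ring.
have su s m : (s <= m)%N -> (s * u <= m * u)%N by move=> sm; rewrite leq_mul2r sm orbT.
have eRS s : (s < q.+1)%N -> eR s = eR s.+1 + u%:R * h n.
  move=> sq; rewrite /eR -mulrDl -natrD; congr (_%:R * _).
  have := su s.+1 q.+1 sq; rewrite !mulSn; lia.
pose i := (j.+1 + q * u)%N; pose i' := (k - q.+1 * u)%N.
have gap : (i + u <= i')%N.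
  move: uD; rewrite qu /i /i'; move: (q * u)%N (q.+1 * u)%N => a b; clear -jk; lia.
have i'n : (i' < n)%N by apply: leq_ltn_trans kn; exact: leq_subr.
have hL s : (s < q)%N -> eL s + u%:R * h n <= n%:R * h n.
  move=> sq; rewrite -eLS ler_wpM2r ?(ltW h0)// ler_nat.
  have := su s.+1 q sq; lia.
have hR s : (s < q.+1)%N -> eR s.+1 + u%:R * h n <= n%:R * h n.
  by move=> sq; rewrite -eRS// ler_wpM2r ?(ltW h0)// ler_nat; lia.
pose VL := void_union n u eL q; pose VR := void_union n u (eR \o succn) q.+1.
have locL w : ~ VL w -> cell_trace n x y j w =
    local_trace M S n l1 l2 p (-1) (i%:R * h n) (Num.max x (j%:R * h n)) (Num.min y (j.+1%:R * h n)) w.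
  move=> nV; apply: (loop_sum_left (e := eL)).
  - exact: (points_sorted MS).
  - exact: (points_sorted MS).
  - by apply: sub_all (points_ge0 MS l1 w n0) => z /= z0; apply: lt_le_trans z0; lra.
  - by apply: sub_all (points_ge0 MS l2 w n0) => z /= z0; apply: lt_le_trans z0; lra.
  - by move=> s; rewrite eLS lerDl.
  - move=> s sq; rewrite eLS !(not_void_union nV)// eqxx ?orbT//.
  - by move=> z /andP[_]; rewrite le_min /eL mul0n addn0 => /andP[].
have locR w : ~ VR w -> cell_trace n x y k w =
    local_trace M S n l1 l2 p (i'%:R * h n) (n%:R * h n) (Num.max x (k%:R * h n)) (Num.min y (k.+1%:R * h n)) w.
  move=> nV; apply: (loop_sum_right (e := eR)).
  - exact: (points_sorted MS).
  - exact: (points_sorted MS).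
  - exact: (points_le MS).
  - exact: (points_le MS).
  - by move=> s; rewrite ler_wpM2r ?(ltW h0)// ler_nat leq_sub2l// mulSn leq_addl.
  - move=> s sq; rewrite (eRS _ sq).
    by rewrite !(not_void_union (e := eR \o succn) nV)// eqxx ?orbT.
  - by move=> z /andP[]; rewrite gt_max /eR mul0n subn0 => /andP[_ ->].
have v0 : 0 < u.+1%:R :> R by rewrite ltr0n.
pose phi : R := (q.+1 * 2)%:R * (C2 / u.+1%:R ^+ 4).
have pV : 0 <= C2 / u.+1%:R ^+ 4 by rewrite divr_ge0// exprn_ge0.
have pL : pr VL <= phi.
  apply: le_trans (void_union_le n0 eL0 hL) _.
  by rewrite ler_wpM2r// ler_nat leq_mul2r leqnSn.
have pR : pr VR <= phi by apply: void_union_le => // s; exact: eR0.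
have [m1 m1'] := moment l1 n0 (ltn_trans jk kn).
have [m2 m2'] := moment l1 n0 kn.
have main := @cov_mixing_local d T R P
  (incr_sigma h M S n 0 i) (incr_sigma h M S n i' n)
  (C3 / u.+1%:R ^+ 4) phi u.+1%:R C1 (cell_trace n x y j) (cell_trace n x y k)
  (local_trace M S n l1 l2 p (-1) (i%:R * h n) (Num.max x (j%:R * h n)) (Num.min y (j.+1%:R * h n)))
  (local_trace M S n l1 l2 p (i'%:R * h n) (n%:R * h n) (Num.max x (k%:R * h n)) (Num.min y (k.+1%:R * h n)))
  (fun w => (count_in n l1 (j%:R * h n) (j.+1%:R * h n) w)%:R)
  (fun w => (count_in n l1 (k%:R * h n) (k.+1%:R * h n) w)%:R) VL VR.
have F0 : incr_sigma h M S n 0 i set0 by exact: incr_sigma0.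
have G0 : incr_sigma h M S n i' n set0 by exact: incr_sigma0.
have {}main := main (incr_sigma_sub MS n0) (incr_sigma_sub MS n0) F0 G0.
apply: le_trans (main _ _ _ _ _ _ _ _ _ _ _ _ m1 m2 m1' m2' _ _ _ _ pL pR) _; clear main.
- by move=> A B; apply: (@mixing n u i i').
- by move=> c; exact: (local_trace_sigma_left h_gt0 MS).
- by move=> c; apply: (local_trace_sigma_right h_gt0 MS) => //; exact: ltnW.
- by rewrite (ler_nat _ 1).
- exact: measurable_cell_trace.
- exact: measurable_cell_trace.
- exact: (measurable_local_trace_left h_gt0 MS).
- by apply: (measurable_local_trace_right h_gt0 MS) => //; exact: ltnW.
- by move=> w; exact: cell_trace_bounds.
- by move=> w; exact: cell_trace_bounds.
- by move=> w; exact: loop_sum_ge0.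
- by move=> w; exact: loop_sum_ge0.
- exact: measurable_void_union.
- by apply: measurable_void_union => // s; exact: eR0.
- exact: locL.
- exact: locR.
have kj0 : 0 < (k - j)%:R :> R by rewrite ltr0n subn_gt0.
have hkj : (k - j)%:R <= u.+1%:R * D%:R :> R by rewrite -natrM ler_nat.
have D0 : 0 < D%:R :> R by rewrite ltr0n.
rewrite /phi ler_pdivlMr ?exprn_gt0//.
apply: (@le_trans _ _ ((4 * (1 + C1) ^+ 2 / u.+1%:R ^+ 2 + u.+1%:R ^+ 2 *
  (4 * ((q.+1 * 2)%:R * (C2 / u.+1%:R ^+ 4)) + C3 / u.+1%:R ^+ 4)) * (u.+1%:R * D%:R) ^+ 2)).
  apply: ler_wpM2l; last by rewrite lerXn2r ?nnegrE// mulr_ge0// ltW.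
  apply: addr_ge0; first by apply: divr_ge0; [exact: mulr_ge0 (sqr_ge0 _)|exact: sqr_ge0].
  apply: mulr_ge0; first exact: sqr_ge0.
  by apply: addr_ge0; [apply: mulr_ge0 => //; exact: mulr_ge0|apply: divr_ge0 => //; exact: exprn_ge0].
rewrite /Kcov -/q -/D natrM le_eqVlt; apply/orP; left; apply/eqP.
by field; rewrite gt_eqF.
Qed.

End cells.

(** * Variance of a block *)

Section inverse_squares.
Context {R : realType}.

Definition inv_sq (k : nat) : R := k.+1%:R ^- 2.

Lemma inv_sq_ge0 k : 0 <= inv_sq k.
Proof. by rewrite invr_ge0 exprn_ge0. Qed.

(** Comparison with the telescoping sum of 1/k - 1/(k+1). *)
Lemma sum_inv_sq n : \sum_(0 <= k < n) inv_sq k <= 2.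
Proof.
case: n => [|n]; first by rewrite big_nil.
suff : \sum_(0 <= k < n.+1) inv_sq k <= 2 - n.+1%:R^-1.
  by move=> h; apply: le_trans h _; rewrite gerBl invr_ge0.
elim: n => [|n IHn]; first by rewrite big_nat1 /inv_sq expr1n invr1; lra.
rewrite big_nat_recr//=; apply: le_trans (lerD IHn (lexx _)) _.
rewrite /inv_sq; set a : R := n.+1%:R; have a0 : 0 < a by rewrite ltr0n.
have -> : n.+2%:R = a + 1 :> R by rewrite -natr1.
have -> : 2 - (a + 1)^-1 = (2 - a^-1 + (a + 1) ^- 2) + (a * (a + 1) ^+ 2)^-1.
  by field; rewrite !gt_eqF//; lra.
by rewrite lerDl invr_ge0 mulr_ge0 ?sqr_ge0 ?ltW.
Qed.

(** Both truncated differences are added, one of them being 0. *)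
Lemma sum_inv_sq_dist n j : (j <= n)%N ->
  \sum_(0 <= k < n) inv_sq ((j - k) + (k - j))%N <= 4.
Proof.
move=> jn; rewrite (big_cat_nat _ (n := j))//=.
have -> : 4 = 2 + 2 :> R by ring.
apply: lerD.
  rewrite big_nat_rev /= add0n; apply: le_trans (sum_inv_sq j).
  rewrite big_nat [leRHS]big_nat; apply: ler_sum => k /andP[_ kj].
  rewrite /inv_sq lef_pV2 ?posrE ?exprn_gt0 ?ltr0n//.
  rewrite lerXn2r ?nnegrE// ler_nat ltnS.
  by rewrite (_ : j - (j - k.+1) = k.+1)%N ?leq_addr//; [exact: leq_trans (leq_addr _ _)|rewrite subKn].
rewrite -{1}[j]add0n big_addn; apply: le_trans (sum_inv_sq (n - j)).
apply: ler_sum => k _; rewrite addnK (_ : j - (k + j) = 0)%N//.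
by apply/eqP; rewrite subn_eq0 leq_addl.
Qed.

End inverse_squares.

Section blocks.
Context {d : measure_display} {T : measurableType d} {R : realType}.
Variable P : probability T R.
Variables (h : nat -> R) (M : nat -> 'I_2 -> T -> nat).
Variable S : nat -> 'I_2 -> nat -> T -> R.
Hypothesis h_gt0 : forall n, (0 < n)%N -> 0 < h n.
Hypothesis MS : sampling_times h M S.
Notation L1 := (L1 P). Notation Ex := (Ex P). Notation pr := (pr P).
Notation cov := (cov P).
Notation count_in := (count_in M S).

Variables (C1 C2 C3 : R).
Hypotheses (C1_ge0 : 0 <= C1) (C2_ge0 : 0 <= C2) (C3_ge0 : 0 <= C3).
Hypothesis moment : forall n l j, (0 < n)%N -> (j < n)%N ->
  L1 (fun w => (count_in n l (j%:R * h n) (j.+1%:R * h n) w)%:R ^+ 4) /\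
  Ex (fun w => (count_in n l (j%:R * h n) (j.+1%:R * h n) w)%:R ^+ 4) <= C1.
Hypothesis void : forall n l u t, (0 < n)%N -> 0 <= t -> t + u%:R * h n <= n%:R * h n ->
  pr [set w | count_in n l t (t + u%:R * h n) w = 0%N] <= C2 / u.+1%:R ^+ 4.
Hypothesis mixing : forall n u i j A B, (0 < i)%N -> (j < n)%N -> (i + u <= j)%N ->
  incr_sigma h M S n 0 i A -> incr_sigma h M S n j n B ->
  `|pr (A `&` B) - pr A * pr B| <= C3 / u.+1%:R ^+ 4.

Variables (l1 l2 : 'I_2) (p : nat).

Notation cell_trace := (cell_trace h M S l1 l2 p).
Notation Kcov := (Kcov C1 C2 C3 p).

(** The cells are disjoint and cover (0, m h_n]. *)
Lemma sum_cells n (z F : R) m : (0 < n)%N ->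
  \sum_(0 <= j < m) (if j%:R * h n < z <= j.+1%:R * h n then F else 0) =
  if 0 < z <= m%:R * h n then F else 0.
Proof.
move=> n0; have h0 := h_gt0 n0; elim: m => [|m IHm].
  by rewrite big_nil mul0r; case: ltP => //= z0; rewrite leNgt z0.
rewrite big_nat_recr//= IHm.
have m0 : 0 <= m%:R * h n by rewrite mulr_ge0// ltW.
have mm : m%:R * h n <= m.+1%:R * h n by rewrite ler_wpM2r ?ler_nat// ltW.
have [zm|mz] := leP z (m%:R * h n).
  by rewrite andbT /= addr0 (le_trans zm mm) andbT.
by rewrite andbF add0r (le_lt_trans m0 mz).
Qed.

Lemma block_split n x y w : (0 < n)%N ->
  trace_in M S n l1 l2 p x y w = \sum_(0 <= j < n) cell_trace n x y j w.
Proof.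
move=> n0; rewrite /trace_in /loop_sum.
under [RHS]eq_bigr do rewrite /cell_trace /trace_in /loop_sum big_mkcond.
rewrite exchange_big [LHS]big_mkcond /=; apply: eq_big_seq => I hI.
have hI2 : 0 < I.2 <= n%:R * h n.
  have [I1 I2] := intervals_mem hI.
  rewrite (allP (points_le MS l1 w n0) _ I2) andbT.
  apply: le_lt_trans (intervals_lt (points_sorted MS l1 w n0) hI).
  exact: (allP (points_ge0 MS l1 w n0)).
under eq_bigr do rewrite gt_max le_min andbACA if_and.
case: ifP => _; last by rewrite big1.
by rewrite (sum_cells I.2 _ n n0) hI2.
Qed.

Definition meets n (x y : R) j := (j%:R * h n < y) && (x < j.+1%:R * h n).

(** Cells which meet the block; the others contribute 0. *)
Definition met n x y := [seq j <- index_iota 0 n | meets n x y j].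

Lemma cell_trace_unmet n x y j w : ~~ meets n x y j -> cell_trace n x y j w = 0.
Proof.
move=> nm; rewrite /cell_trace /trace_in /loop_sum big_pred0// => I.
apply: contraNF nm; rewrite gt_max le_min /meets => /andP[/andP[h1 h2] /andP[h3 h4]].
by rewrite (lt_le_trans h2 h3) (lt_le_trans h1 h4).
Qed.

Lemma block_split_met n x y w : (0 < n)%N ->
  trace_in M S n l1 l2 p x y w = \sum_(j <- met n x y) cell_trace n x y j w.
Proof.
move=> n0; rewrite block_split// big_filter [RHS]big_mkcond /=.
by apply: eq_bigr => j _; case: ifPn => // /cell_trace_unmet ->.
Qed.

(** Each cell which meets (x, y] is contained in (x - h_n, y + h_n], and the
cells are disjoint. *)
Lemma size_met n x y : (0 < n)%N -> x <= y ->
  (size (met n x y))%:R * h n <= y - x + 2 * h n.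
Proof.
move=> n0 xy; have h0 := h_gt0 n0.
have ss : sorted <%R (path_points n (fun j => j%:R * h n)).
  by apply: path_points_sorted => i _; rewrite ltr_pM2r// ltr_nat.
have JJ : (x - h n, y + h n).1 < (x - h n, y + h n).2 :> R by rewrite /=; lra.
have := sum_overlap_intervals ss JJ; rewrite sum_intervals_path_points /itv_len /=.
have -> : y - x + 2 * h n = y + h n - (x - h n) by ring.
apply: le_trans; rewrite -(big_mkord xpredT (fun i => overlap (i%:R * h n, i.+1%:R * h n) _)).
rewrite size_filter -sum1_count mulr_natl -sumrMnr big_mkcond /=.
apply: ler_sum => j _; case: ifPn => [/andP[h1 h2]|_]; last exact: overlap_ge0.
have jE : j.+1%:R * h n = j%:R * h n + h n by rewrite -natr1 mulrDl mul1r.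
rewrite mulr1n /overlap /= jE in h2 *.
rewrite (min_idPl _); last by lra.
rewrite [Num.max (j%:R * h n) _](max_idPl _); last by lra.
by rewrite le_max; apply/orP; right; lra.
Qed.

Lemma L1_count_pow4 n l j : (0 < n)%N ->
  L1 (fun w => (count_in n l (j%:R * h n) (j.+1%:R * h n) w)%:R ^+ 4).
Proof.
move=> n0; have [jn|nj] := ltnP j n; first by have [] := moment l n0 jn.
rewrite (_ : (fun w => _) = fun=> 0); first exact: L1_cst.
apply/funext => w; rewrite /count_in (eq_in_count (a2 := pred0)).
  by rewrite count_pred0 expr0n.
move=> z /(allP (points_le MS l w n0)) /= zn; apply/negbTE; rewrite negb_and -leNgt.
apply/orP; left; apply: le_trans zn _.
by apply: ler_wpM2r; rewrite ?ler_nat// ltW// h_gt0.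
Qed.

Lemma L1_one_add_count_pow4 n l j : (0 < n)%N ->
  L1 (fun w => 1 + (count_in n l (j%:R * h n) (j.+1%:R * h n) w)%:R ^+ 4).
Proof. by move=> n0; apply: L1D; [exact: L1_cst|exact: L1_count_pow4]. Qed.

Lemma cell_trace_pow_le n x y j k w : (0 < n)%N -> (k <= 4)%N ->
  `|cell_trace n x y j w| ^+ k <= 1 + (count_in n l1 (j%:R * h n) (j.+1%:R * h n) w)%:R ^+ 4.
Proof.
move=> n0 k4; have /andP[c0 cN] := cell_trace_bounds MS l1 l2 p x y j w n0.
rewrite ger0_norm//; apply: le_trans (le_one_pow4 (k := k) _ k4) => //.
by rewrite lerXn2r ?nnegrE.
Qed.

Lemma L1_cell_trace n x y j : (0 < n)%N -> L1 (cell_trace n x y j).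
Proof.
move=> n0; apply: L1_le (L1_one_add_count_pow4 l1 j n0).
  exact: (measurable_cell_trace h_gt0 MS).
by move=> w; rewrite -[leLHS]expr1; exact: cell_trace_pow_le.
Qed.

Lemma L1_cell_trace_mul n x y j k : (0 < n)%N -> L1 (fun w => cell_trace n x y j w * cell_trace n x y k w).
Proof.
move=> n0; apply: L1_le (L1D (L1_one_add_count_pow4 l1 j n0) (L1_one_add_count_pow4 l1 k n0)).
  by apply: measurable_funM; exact: (measurable_cell_trace h_gt0 MS).
move=> w; apply: le_trans (lerD (cell_trace_pow_le x y j w n0 (isT : 2 <= 4)%N)
  (cell_trace_pow_le x y k w n0 (isT : 2 <= 4)%N)).
rewrite normrM; set a := `|_|; set b := `|_|.
by have := sqr_ge0 (a - b); have := sqr_ge0 (a + b); rewrite !expr2; lra.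
Qed.

Lemma cell_var n x y j : (0 < n)%N -> (j < n)%N ->
  `|cov (cell_trace n x y j) (cell_trace n x y j)| <= (1 + C1) + (1 + C1) ^+ 2.
Proof.
move=> n0 jn; have [m1 m2] := moment l1 n0 jn.
have LN := L1_one_add_count_pow4 l1 j n0.
have mc := measurable_cell_trace h_gt0 MS l1 l2 p x y j n0.
apply: le_trans (cov_dom mc mc LN LN LN _ _ _) _.
- by move=> w; rewrite -expr2; exact: cell_trace_pow_le.
- by move=> w; rewrite -[leLHS]expr1; exact: cell_trace_pow_le.
- by move=> w; rewrite -[leLHS]expr1; exact: cell_trace_pow_le.
rewrite ExD ?Ex_cst//; last exact: L1_cst.
have E0 : 0 <= Ex (fun w => (count_in n l1 (j%:R * h n) (j.+1%:R * h n) w)%:R ^+ 4).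
  by apply: Ex_ge0 => w; rewrite exprn_ge0.
rewrite expr2 lerD ?lerD2l// ler_pM ?addr_ge0 ?lerD2l//.
Qed.

Definition Kvar : R := 4 * Kcov + ((1 + C1) + (1 + C1) ^+ 2).

Lemma Kvar_ge0 : 0 <= Kvar.
Proof.
have := Kcov_ge0 C1 C2_ge0 C3_ge0 p => K0.
by rewrite /Kvar !addr_ge0// ?sqr_ge0// mulr_ge0.
Qed.

(** The distance of distinct cells is at least 1, hence the factor 4 in Kvar
when |j - k| is replaced by |j - k| + 1. *)
Lemma cell_cov_all n x y j k : (0 < n)%N -> (j < n)%N -> (k < n)%N ->
  cov (cell_trace n x y j) (cell_trace n x y k) <= Kvar * inv_sq ((j - k) + (k - j))%N.
Proof.
move=> n0.
have K0 := Kcov_ge0 C1 C2_ge0 C3_ge0 p.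
have C10 : 0 <= (1 + C1) + (1 + C1) ^+ 2 by rewrite !addr_ge0// sqr_ge0.
wlog jk : j k / (j <= k)%N.
  move=> wlg jn kn; have [jk|kj] := leqP j k; first exact: wlg.
  by rewrite covC addnC; apply: wlg => //; exact: ltnW.
move=> jn kn; apply: le_trans (ler_norm _) _.
move: jk; rewrite leq_eqVlt => /orP[/eqP <-|jk].
  apply: le_trans (cell_var x y n0 jn) _.
  by rewrite subnn addn0 /inv_sq expr1n invr1 mulr1 /Kvar lerDr mulr_ge0.
apply: le_trans (cell_cov h_gt0 MS C1_ge0 C2_ge0 C3_ge0 moment void mixing l1 l2 p x y n0 jk kn) _.
have -> : (j - k = 0)%N by apply/eqP; rewrite subn_eq0 ltnW.
rewrite add0n /inv_sq; have : (0 < k - j)%N by rewrite subn_gt0.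
move: (k - j)%N => g g0.
apply: (@le_trans _ _ (4 * Kcov / g.+1%:R ^+ 2)); last first.
  by rewrite ler_wpM2r ?invr_ge0 ?sqr_ge0// /Kvar lerDl.
move: Kcov K0 => K K0.
have g0' : 0 < g%:R :> R by rewrite ltr0n.
have g1 : 1 <= g%:R :> R by rewrite (ler_nat _ 1).
rewrite ler_pdivlMr ?exprn_gt0// mulrAC ler_pdivrMr ?exprn_gt0//.
rewrite [4 * K]mulrC -[K * 4 * _]mulrA; apply: ler_wpM2l => //; rewrite -natr1.
have : 0 <= (g%:R - 1) * (3 * g%:R + 1) :> R by rewrite mulr_ge0//; lra.
by rewrite !expr2; lra.
Qed.

Lemma mem_met n x y j : j \in met n x y -> (j < n)%N.
Proof. by rewrite mem_filter mem_index_iota => /andP[_ /andP[]]. Qed.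

Lemma block_var n x y : (0 < n)%N ->
  \sum_(j <- met n x y) \sum_(k <- met n x y) cov (cell_trace n x y j) (cell_trace n x y k)
    <= (size (met n x y))%:R * (4 * Kvar).
Proof.
move=> n0; rewrite mulr_natl -sum1_size -sumrMnr big_seq [leRHS]big_seq.
apply: ler_sum => j jm; have jn := mem_met jm; rewrite mulr1n.
apply: (@le_trans _ _ (\sum_(k <- met n x y) Kvar * inv_sq ((j - k) + (k - j))%N)).
  rewrite big_seq [leRHS]big_seq; apply: ler_sum => k km.
  exact: cell_cov_all (mem_met km).
rewrite -mulr_sumr mulrC ler_wpM2r ?Kvar_ge0//.
apply: le_trans (sum_inv_sq_dist (ltnW jn)); rewrite big_filter big_mkcond /=.
by apply: ler_sum => k _; case: ifP => // _; exact: inv_sq_ge0.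
Qed.

Lemma L1_block n x y : (0 < n)%N -> L1 (trace_in M S n l1 l2 p x y).
Proof.
move=> n0; rewrite (_ : trace_in _ _ _ _ _ _ _ _ = fun w => \sum_(j <- met n x y) cell_trace n x y j w).
  by apply: L1_sum => j; exact: L1_cell_trace.
by apply/funext => w; exact: block_split_met.
Qed.

Lemma block_chebyshev n x y (e : R) : (0 < n)%N -> 0 < e -> x <= y -> y <= x + 1 ->
  pr [set w | e < `|trace_in M S n l1 l2 p x y w - Ex (trace_in M S n l1 l2 p x y)|]
    <= (1 + 2 * h n) / h n * (4 * Kvar) / e ^+ 2.
Proof.
move=> n0 e0 xy yx1.
rewrite (_ : trace_in _ _ _ _ _ _ _ _ = fun w => \sum_(j <- met n x y) cell_trace n x y j w); last first.
  by apply/funext => w; exact: block_split_met.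
apply: le_trans (chebyshev_sum e0 _ _ (block_var x y n0)) _.
- by move=> j; exact: L1_cell_trace.
- by move=> j k; exact: L1_cell_trace_mul.
apply: ler_wpM2r; first by rewrite invr_ge0 sqr_ge0.
apply: ler_wpM2r; first exact: mulr_ge0 Kvar_ge0.
rewrite ler_pdivlMr ?h_gt0//; apply: le_trans (size_met n0 xy) _; lra.
Qed.

Lemma block_mean n x y : (0 < n)%N -> x <= y -> y <= x + 1 ->
  Ex (trace_in M S n l1 l2 p x y) <= (1 + 2 * h n) / h n * (1 + C1).
Proof.
move=> n0 xy yx1.
rewrite (_ : trace_in _ _ _ _ _ _ _ _ = fun w => \sum_(j <- met n x y) cell_trace n x y j w); last first.
  by apply/funext => w; exact: block_split_met.
rewrite Ex_sum; last by move=> j; exact: L1_cell_trace.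
apply: (@le_trans _ _ ((size (met n x y))%:R * (1 + C1))).
  rewrite mulr_natl -sum1_size -sumrMnr big_seq [leRHS]big_seq.
  apply: ler_sum => j jm; have jn := mem_met jm; rewrite mulr1n.
  have [m1 m2] := moment l1 n0 jn.
  apply: (@le_trans _ _ (Ex (fun w => 1 + (count_in n l1 (j%:R * h n) (j.+1%:R * h n) w)%:R ^+ 4))).
    apply: Ex_le; [exact: L1_cell_trace|exact: L1_one_add_count_pow4|move=> w].
    by apply: le_trans (ler_norm _) _; rewrite -[leLHS]expr1; exact: cell_trace_pow_le.
  by rewrite ExD ?Ex_cst ?lerD2l//; exact: L1_cst.
apply: ler_wpM2r; first exact: addr_ge0.
rewrite ler_pdivlMr ?h_gt0//.
by apply: le_trans (size_met n0 xy) _; lra.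
Qed.

End blocks.

(** * Convergence in probability *)

Section partitions.
Context {R : realType}.
Implicit Types (s : nat -> R).

(** The extended-real bounds on the mesh, as a real lower bound dl and the upper
bound 1. *)
Lemma good_partition_mesh s : good_partition s -> s 0%N = 0 /\
  exists2 dl : R, 0 < dl & forall k, dl <= s k.+1 - s k <= 1.
Proof.
move=> [s0 sS sup1 inf0]; split=> //.
have ub k : s k.+1 - s k <= 1.
  rewrite -lee_fin; apply: le_trans sup1; apply: ereal_sup_ubound.
  by exists k.+1 => //=; rewrite ger0_norm// subr_ge0 ltW.
set S := [set _ | _ in _] in inf0.
have lb k : (ereal_inf S <= (s k.+1 - s k)%:E)%E.
  apply: ereal_inf_lbound; exists k.+1 => //=.
  by rewrite ger0_norm// subr_ge0 ltW.
move: (ereal_inf S) inf0 lb => [r r0 lb|_ /(_ 0%N)//|//].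
by exists r => // k; rewrite ub andbT -lee_fin.
Qed.

Lemma good_partition_growth s dl : s 0%N = 0 -> (forall k, dl <= s k.+1 - s k <= 1) ->
  forall k, dl * k%:R <= s k.
Proof.
move=> s0 hs; elim=> [|k IHk]; first by rewrite mulr0 s0.
by rewrite -natr1 mulrDr mulr1; have := hs k; lra.
Qed.

(** The maximum in the definition of last_index is attained, because s grows at
least linearly. *)
Lemma last_indexP s (t : R) : good_partition s -> 0 <= t ->
  s (last_index s t) <= t /\ forall k, s k <= t -> (k <= last_index s t)%N.
Proof.
move=> gs t0; have [s0 [dl dl0 hs]] := good_partition_mesh gs.
have gr := good_partition_growth s0 hs.
suff [q hq] : exists q, s q <= t /\ forall k, s k <= t -> (k <= q)%N.
  by rewrite /last_index; case: xgetP => [k _ []//|/(_ q)[]//].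
have ex : exists k, s k <= t by exists 0%N; rewrite s0.
have td0 : 0 <= t / dl by rewrite divr_ge0// ltW.
have bd k : s k <= t -> (k <= Num.bound (t / dl))%N.
  move=> skt; rewrite -(ler_nat R); apply: le_trans (ltW (archi_boundP td0)).
  by rewrite ler_pdivlMr// mulrC; exact: le_trans (gr k) skt.
by case: (ex_maxnP ex bd) => q hq hmax; exists q; split.
Qed.

Lemma bigmax_gt (I : eqType) (r : seq I) (F : I -> R) (e : R) : 0 <= e ->
  e < \big[Num.max/0]_(i <- r) F i -> exists2 i, i \in r & e < F i.
Proof.
move=> e0; elim: r => [|i r IHr]; first by rewrite big_nil ltNge e0.
rewrite big_cons lt_max => /orP[h|/IHr[j jr h]]; first by exists i; rewrite ?mem_head.
by exists j; rewrite // in_cons jr orbT.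
Qed.

End partitions.

Section convergence.
Context {d : measure_display} {T : measurableType d} {R : realType}.
Variable P : probability T R.
Variables (h : nat -> R) (M : nat -> 'I_2 -> T -> nat).
Variable S : nat -> 'I_2 -> nat -> T -> R.
Hypothesis h_gt0 : forall n, (0 < n)%N -> 0 < h n.
Hypothesis h_cvg : h n @[n --> \oo] --> 0.
Hypothesis nh2_cvg : n%:R * h n ^+ 2 @[n --> \oo] --> 0.
Hypothesis MS : sampling_times h M S.
Notation L1 := (L1 P). Notation Ex := (Ex P). Notation pr := (pr P).
Notation count_in := (count_in M S).

Variables (l1 l2 : 'I_2) (p : nat).
Variable K : R.
Hypothesis K_ge0 : 0 <= K.
Hypothesis block_L1 : forall n x y, (0 < n)%N -> L1 (trace_in M S n l1 l2 p x y).
Hypothesis block_dev : forall n x y (e : R), (0 < n)%N -> 0 < e -> x <= y -> y <= x + 1 ->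
  pr [set w | e < `|trace_in M S n l1 l2 p x y w - Ex (trace_in M S n l1 l2 p x y)|]
    <= (1 + 2 * h n) / h n * K / e ^+ 2.

Variables (s : nat -> R) (Y : nat -> nat -> T -> R) (a : R).
Hypothesis s_good : good_partition s.
Hypothesis YE : forall n k w, (0 < n)%N ->
  Y n k w = trace_in M S n l1 l2 p (s k.-1) (s k) w.

Lemma measurable_bigmax (I : Type) (r : seq I) (F : I -> T -> R) :
  (forall i, measurable_fun setT (F i)) ->
  measurable_fun setT (fun w => \big[Num.max/0]_(i <- r) F i w).
Proof.
move=> mF; elim: r => [|i r IHr].
  by under eq_fun do rewrite big_nil; exact: measurable_cst.
by under eq_fun do rewrite big_cons; exact: measurable_maxr.
Qed.

(** Union bound over the blocks.  There are at most n h_n / dl of them, and the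
deviation of each from its mean by more than e / (2 h_n) has probability
O(h_n). *)
Lemma deviation_bound (dl e : R) n : (forall k, dl <= s k.+1 - s k <= 1) -> 0 < dl ->
  0 < e -> (0 < n)%N -> h n <= 1 ->
  (\big[maxe/0]_(1 <= k < (qn h s n).+1)
      `|(h n)%:E * 'E_P[Y n k] - (a * (s k - s k.-1))%:E| < (e / 2)%:E)%E ->
  (P [set w | (e < `|\big[Num.max/0]_(1 <= k < (qn h s n).+1)
                            `|h n * Y n k w - a * (s k - s k.-1)| - 0|)%R]
    <= (12 * K / (dl * e ^+ 2) * (n%:R * h n ^+ 2))%:E)%E.
Proof.
move=> hs dl0 e0 n0 h1 hmean; have h0 := h_gt0 n0.
have [s0 _] := good_partition_mesh s_good.
have YnE k : Y n k = trace_in M S n l1 l2 p (s k.-1) (s k).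
  by apply/funext => w; exact: YE.
have LY k : L1 (Y n k) by rewrite YnE; exact: block_L1.
have mY k := L1_measurable (LY k).
set q := qn h s n.
have qbound : q%:R <= n%:R * h n / dl.
  have nh0 : 0 <= n%:R * h n by rewrite mulr_ge0// ltW.
  rewrite ler_pdivlMr// mulrC; apply: le_trans (good_partition_growth s0 hs q) _.
  by have [] := last_indexP s_good nh0.
have e2h : 0 < e / (2 * h n) by rewrite divr_gt0// mulr_gt0.
pose D k := [set w | e / (2 * h n) < `|Y n k w - Ex (Y n k)|].
have mgt (f : T -> R) c : measurable_fun setT f -> measurable [set w | c < f w].
  move=> mf; rewrite -[X in measurable X]setTI.
  exact: (measurable_fun_ltr (f := fun=> c)).
have mD k : measurable (D k).
  by apply: mgt; apply: measurableT_comp => //; exact: measurable_funB.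
have mA : measurable [set w | e < `|\big[Num.max/0]_(1 <= k < q.+1)
                            `|h n * Y n k w - a * (s k - s k.-1)| - 0|].
  apply: mgt; apply: measurableT_comp => //; apply: measurable_funB => //.
  apply: measurable_bigmax => k; apply: measurableT_comp => //.
  by apply: measurable_funB => //; exact: measurable_funM.
rewrite (prE P mA) lee_fin.
apply: le_trans (pr_union_le (r := index_iota 1 q.+1) (D := D)
  (phi := (1 + 2 * h n) / h n * K / (e / (2 * h n)) ^+ 2) mD mA _ _) _.
- move=> w /=; rewrite subr0 ger0_norm; last first.
    by elim/big_ind: _ => // x y x0 y0; rewrite le_max x0.
  move=> /(bigmax_gt (ltW e0))[k kr ek]; exists k => //; rewrite /D /=.
  have mk : `|h n * Ex (Y n k) - a * (s k - s k.-1)| < e / 2.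
    rewrite -lte_fin; apply: le_lt_trans hmean.
    apply: le_trans (le_bigmax_seq _ k _ _ kr isT).
    rewrite unlock -[X in (_ <= `|_ * X - _|)%E]fineK; last exact: integrable_fin_num (LY k).
    by rewrite lee_fin.
  have tri : `|h n * Y n k w - a * (s k - s k.-1)| <=
      h n * `|Y n k w - Ex (Y n k)| + `|h n * Ex (Y n k) - a * (s k - s k.-1)|.
    rewrite -{2}(gtr0_norm h0) -normrM [h n * (_ - _)]mulrBr.
    by apply: le_trans (ler_normD _ _); rewrite addrA subrK.
  by rewrite ltr_pdivrMr ?mulr_gt0//; lra.
- move=> k; rewrite mem_index_iota => /andP[k0 _]; rewrite /D YnE.
  by apply: block_dev => //; case: k k0 => //= k _; have := hs k; lra.
rewrite size_iota subSS subn0.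
have -> : (1 + 2 * h n) / h n * K / (e / (2 * h n)) ^+ 2 =
    (1 + 2 * h n) * (4 * h n * K / e ^+ 2).
  by field; rewrite !gt_eqF.
have c0 : 0 <= 4 * h n * K / e ^+ 2.
  by apply: divr_ge0; [apply: mulr_ge0 => //; apply: mulr_ge0 => //; exact: ltW|exact: sqr_ge0].
have -> : 12 * K / (dl * e ^+ 2) * (n%:R * h n ^+ 2) =
    (n%:R * h n / dl) * (3 * (4 * h n * K / e ^+ 2)).
  by field; rewrite !gt_eqF.
apply: ler_pM => //; first by apply: mulr_ge0 => //; lra.
by apply: ler_wpM2r => //; lra.
Qed.

Lemma cvg_mean_prob : cvg_max_mean P h s Y a -> cvg_max_prob P h s Y a.
Proof.
move=> hmean e e0.
have [s0 [dl dl0 hs]] := good_partition_mesh s_good.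
pose B := 12 * K / (dl * e ^+ 2).
have ub : (B * (n%:R * h n ^+ 2))%:E @[n --> \oo] --> 0%:E.
  apply: cvg_EFin; first exact: nearW.
  by rewrite -[X in _ --> X](mulr0 B); apply: cvgM nh2_cvg; exact: cvg_cst.
apply: (squeeze_cvge (f := cst 0%E) _ _ ub); last exact: cvg_cst.
have e20 : 0 < e / 2 by rewrite divr_gt0.
have lt0 : (0%:E < (e / 2)%:E)%E by rewrite lte_fin.
have near_mean := hmean [set u | (u < (e / 2)%:E)%E] (open_ereal_lt' lt0).
near=> n.
have n0 : (0 < n)%N by near: n; exact: nbhs_infty_gt.
have h1 : h n <= 1 by near: n; exact: (cvgr_le _ h_cvg).
rewrite measure_ge0 /=.
apply: (deviation_bound hs dl0 e0 n0 h1).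
by near: n; exact: near_mean.
Unshelve. all: by end_near.
Qed.

(** Markov's inequality: h_n times the mean of the last block is bounded, since
a convergent sequence is bounded. *)
Lemma tight_last_block (C : R) : 0 <= C ->
  (forall n x y, (0 < n)%N -> x <= y -> y <= x + 1 ->
     Ex (trace_in M S n l1 l2 p x y) <= (1 + 2 * h n) / h n * C) ->
  tight P (fun n w => h n * Y n (qn h s n).+1 w).
Proof.
move=> C0 hC e e0.
have [s0 [dl dl0 hs]] := good_partition_mesh s_good.
have [H [H0 hH]] : exists H, 0 <= H /\ forall n, `|h n| <= H.
  have /cvg_seq_bounded[H [_ hH]] : cvgn h by apply/cvg_ex; exists 0.
  (* the bound H holds for every number strictly above it *)
  exists (`|H| + 1); split; first by rewrite addr_ge0.
  by move=> n; apply: hH => //; have := ler_norm H; lra.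
(* adding 1 keeps the threshold positive *)
exists ((1 + 2 * H) * C / e + 1) => n n0; have h0 := h_gt0 n0.
set k := (qn h s n).+1.
have YnE : Y n k = trace_in M S n l1 l2 p (s k.-1) (s k).
  by apply/funext => w; exact: YE.
have LY : L1 (Y n k) by rewrite YnE; exact: block_L1.
have Y0 w : 0 <= Y n k w by rewrite YnE; exact: loop_sum_ge0.
have KC0 : 0 <= (1 + 2 * H) * C / e.
  by apply: divr_ge0; [apply: mulr_ge0 => //; lra|exact: ltW].
have -> : [set w | (1 + 2 * H) * C / e + 1 < `|h n * Y n k w|] =
   [set w | (1 + 2 * H) * C / e + 1 < h n * Y n k w].
  by apply/seteqP; split => w /=; rewrite ger0_norm// mulr_ge0// ltW.
have K0 : 0 < (1 + 2 * H) * C / e + 1 by lra.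
have := markov_ineq K0 (L1Z (h n) LY) (fun w => mulr_ge0 (ltW h0) (Y0 w)).
rewrite prE; last first.
  rewrite -[X in measurable X]setTI.
  apply: (measurable_fun_ltr (f := fun=> _)) => //.
  exact: L1_measurable (L1Z (h n) LY).
rewrite lee_fin => hm; apply: le_trans hm _.
rewrite ler_pdivrMr// ExZ// mulrDr mulr1 mulrCA mulfV ?gt_eqF// mulr1.
have hsk := hs (qn h s n).
apply: (@le_trans _ _ ((1 + 2 * H) * C)); last by rewrite lerDl ltW.
apply: (@le_trans _ _ (h n * ((1 + 2 * h n) / h n * C))).
  rewrite ler_pM2l// YnE; apply: hC => //; rewrite /k /=; lra.
rewrite -mulrA mulrCA [h n * _]mulrA mulfV ?gt_eqF// mul1r.
apply: ler_wpM2r => //; have := hH n; rewrite gtr0_norm//; lra.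
Qed.

End convergence.

Unset Implicit Arguments.
Set Strict Implicit.
Set Printing Implicit Defensive.

Theorem proposition2p1 (R : realType) (d : measure_display)
    (T : measurableType d) (P : probability T R)
    (h : nat -> R) (M : nat -> 'I_2 -> T -> nat)
    (S : nat -> 'I_2 -> nat -> T -> R)
    (h_gt0 : forall n, (0 < n)%N -> 0 < h n)
    (h_cvg : h n @[n --> \oo] --> 0)
    (nh_cvg : n%:R * h n @[n --> \oo] --> +oo)
    (nh2_cvg : n%:R * h n ^+ 2 @[n --> \oo] --> 0)
    (MS : sampling_times h M S)
    (HB1 : forall q : R, 0 < q -> B1 P h M S q)
    (HB2 : forall q : R, 0 < q -> B2 P h M S q)
    (Hmix : forall q : R, 0 < q -> mixing_summable P h M S q)
    (Hlim : exists (a0 : 'I_2 -> R) (a1 : nat -> R),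
      [/\ forall l, 0 < a0 l,
          a1 0%N = a0 ord0,
          forall p, (0 < p)%N -> 0 <= a1 p &
          forall (s : nat -> R), good_partition s ->
            (forall l, cvg_max_mean P h s (fun n => Mk M S s n l) (a0 l)) /\
            (forall p, cvg_max_mean P h s (fun n => trk M S s n p) (a1 p))]) :
  (exists a0 : 'I_2 -> R,
    (forall l, 0 < a0 l) /\
    forall l (s : nat -> R), good_partition s ->
      tight P (fun n w => h n * Mk M S s n l (qn h s n).+1 w) /\
      cvg_max_prob P h s (fun n => Mk M S s n l) (a0 l)) /\
  (forall p, (0 < p)%N -> exists2 a : R, 0 <= a &
    forall s : nat -> R, good_partition s ->
      cvg_max_prob P h s (fun n => trk M S s n p) a).
Proof.
(* with exponent 4, truncation at level u + 1 leaves errors O(u^-2), which are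
   summable over the distances of the cells *)
have four_gt0 : 0 < 4%:R :> R by rewrite ltr0n.
have [C1 C1_ge0 moment] := B1_moment h_gt0 MS (HB1 _ four_gt0).
have [C2 C2_ge0 void] := B2_void h_gt0 MS (HB2 _ four_gt0).
have [C3 C3_ge0 mixing] := mixing_rate MS (Hmix _ four_gt0).
have [a0 [a1 [a0_gt0 _ a1_ge0 hlim]]] := Hlim.
have Sincr n l w : (0 < n)%N ->
    forall i, (i < M n l w)%N -> S n l i w < S n l i.+1 w.
  by move=> n0; have [_ _ /(_ w)[]] := MS n l n0.
(* a block count is the trace of the 0th power for the pair (l, l) *)
have MkE s n l k w : (0 < n)%N ->
    Mk M S s n l k w = trace_in M S n l l 0 (s k.-1) (s k) w.
  by move=> n0; rewrite /Mk (block_countE _ _ (Sincr n l w n0)).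
have trkE s n p k w : (0 < n)%N ->
    trk M S s n p k w = trace_in M S n ord0 ord_max p (s k.-1) (s k) w.
  by move=> n0; rewrite /trk (block_traceE (Sincr n ord0 w n0) (Sincr n ord_max w n0)).
have L1b l1 l2 p n x y (n0 : (0 < n)%N) :
    L1 P (trace_in M S n l1 l2 p x y) := L1_block h_gt0 MS moment l1 l2 p x y n0.
have dev l1 l2 p n x y e (n0 : (0 < n)%N) (e0 : 0 < e) (xy : x <= y) (yx : y <= x + 1) :=
  block_chebyshev h_gt0 MS C1_ge0 C2_ge0 C3_ge0 moment void mixing l1 l2 p n0 e0 xy yx.
have mean l1 l2 p n x y (n0 : (0 < n)%N) (xy : x <= y) (yx : y <= x + 1) :=
  block_mean h_gt0 MS C1_ge0 moment l1 l2 p n0 xy yx.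
have K0 p : 0 <= 4 * Kvar C1 C2 C3 p by rewrite mulr_ge0// Kvar_ge0.
split.
  exists a0; split=> // l s s_good; have [hM _] := hlim s s_good; split.
    exact: (tight_last_block (Y := fun n => Mk M S s n l) h_gt0 h_cvg
      (L1b l l 0%N) s_good (fun n k w => MkE s n l k w)
      (addr_ge0 ler01 C1_ge0) (mean l l 0%N)).
  exact: (cvg_mean_prob (Y := fun n => Mk M S s n l) h_gt0 h_cvg nh2_cvg (K0 0%N)
    (L1b l l 0%N) (dev l l 0%N) s_good (fun n k w => MkE s n l k w) (hM l)).
move=> p p_gt0; exists (a1 p); first exact: a1_ge0.
move=> s s_good; have [_ hT] := hlim s s_good.
exact: (cvg_mean_prob (Y := fun n => trk M S s n p) h_gt0 h_cvg nh2_cvg (K0 p)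
  (L1b ord0 ord_max p) (dev ord0 ord_max p) s_good (fun n k w => trkE s n p k w) (hT p)).
Qed.
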